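(* Let $N\ge 2$ and $\gamma\in(0,1]$. Let $\Omega=\{x=(x',x_N)\in\mathbb{R}^{N-1}\times\mathbb{R}: x_N>g(x')\}$ be an epigraph bounded from below and defined by a function $g\in\mathbb{C}^{1,\gamma}(\mathbb{R}^{N-1})$, and let $f\in Lip_{loc}(\mathbb{R})$ with $f(0)<0$. Let $u\in C^1(\overline{\Omega})\cap C^2(\Omega)$ satisfy $$-\Delta u=f(u)\ \text{in }\Omega,\qquad u>0\ \text{in }\Omega,\qquad u=0\ \text{on }\partial\Omega,\qquad \frac{\partial u}{\partial\eta}=\mathfrak{c}\ \text{on }\partial\Omega,$$ where $\mathfrak{c}\in\mathbb{R}$ is a constant with $\mathfrak{c}\ne0$, and assume that $\nabla u$ is bounded on finite strips, i.e. for any $R>0$, $$\sup_{\Omega\cap\{x_N<R\}}|\nabla u|<+\infty.$$ Then $u$ is monotone, i.e. $\frac{\partial u}{\partial x_N}(x)>0$ for all $x\in\Omega$.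
   Context: $\eta$ is the outward unit normal to $\partial\Omega$. The epigraph is bounded from below if $\inf_{\mathbb{R}^{N-1}}g>-\infty$. $\mathbb{C}^{1,\gamma}(\mathbb{R}^{N-1})$ is the set of functions $h\in C^1(\mathbb{R}^{N-1})$ (not necessarily bounded) such that $\nabla h$ is bounded and globally $\gamma$-Hölder continuous, i.e. $\sup_{x}|\nabla h(x)|+\sup_{x\ne y}\frac{|\nabla h(x)-\nabla h(y)|}{|x-y|^\gamma}<+\infty$. $Lip_{loc}(X)$ is the set of locally Lipschitz-continuous functions on $X$. For an open set $U$, $C^k(\overline U)$ denotes the functions in $C^k(U)$ all of whose derivatives of order $\le k$ have continuous (not necessarily bounded) extensions to $\overline U$. *)

(* Defs.v *)
From mathcomp Require Import all_boot all_order all_algebra.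
From mathcomp Require Import all_classical all_reals all_analysis.

Set Implicit Arguments.
Unset Strict Implicit.
Unset Printing Implicit Defensive.

Import Order.TTheory GRing.Theory Num.Theory.
Import numFieldNormedType.Exports.

Local Open Scope classical_set_scope.
Local Open Scope ring_scope.

(* The library norm of ['rV[R]_n] is the sup norm; it induces the usual
   topology, but metric quantities below use the Euclidean structure. *)
Definition dotv (R : realType) (n : nat) (v w : 'rV[R]_n) : R :=
  \sum_(i < n) v ord0 i * w ord0 i.

Definition enorm (R : realType) (n : nat) (v : 'rV[R]_n) : R :=
  Num.sqrt (dotv v v).

Definition partial (R : realType) (n : nat) (i : 'I_n) (f : 'rV[R]_n -> R)
    (x : 'rV[R]_n) : R :=
  'D_(delta_mx ord0 i) f x.

Definition grad (R : realType) (n : nat) (f : 'rV[R]_n -> R) (x : 'rV[R]_n) :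
    'rV[R]_n :=
  \row_(i < n) partial i f x.

Definition laplacian (R : realType) (n : nat) (f : 'rV[R]_n -> R)
    (x : 'rV[R]_n) : R :=
  \sum_(i < n) partial i (partial i f) x.

Definition iter_partial (R : realType) (n : nat) (s : seq 'I_n)
    (f : 'rV[R]_n -> R) : 'rV[R]_n -> R :=
  foldr (@partial R n) f s.

(* C^k(U), for U open: f is total but only its germs at points of U matter. *)
Fixpoint Ck (R : realType) (n k : nat) (U : set 'rV[R]_n)
    (f : 'rV[R]_n -> R) : Prop :=
  if k is k'.+1 then
    (forall x, U x -> differentiable f x) /\
    (forall i, Ck k' U (partial i f))
  else {within U, continuous f}.

Definition has_continuous_ext (R : realType) (n : nat) (U : set 'rV[R]_n)
    (f : 'rV[R]_n -> R) : Prop :=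
  exists2 h : 'rV[R]_n -> R,
    {within closure U, continuous h} & (forall x, U x -> h x = f x).

(* C^k(closure U): the values of f on the boundary are those of its own
   continuous extension; its derivatives only have to be extendable. *)
Definition Ck_closure (R : realType) (n k : nat) (U : set 'rV[R]_n)
    (f : 'rV[R]_n -> R) : Prop :=
  [/\ Ck k U f,
      {within closure U, continuous f} &
      forall s : seq 'I_n, (size s <= k)%N ->
        has_continuous_ext U (iter_partial s f)].

(* Value at x in closure U of the continuous extension of f from U. *)
Definition ext_val (R : realType) (n : nat) (U : set 'rV[R]_n)
    (f : 'rV[R]_n -> R) (x : 'rV[R]_n) : R :=
  lim (f y @[y --> within U (nbhs x)]).

Definition boundary (R : realType) (n : nat) (U : set 'rV[R]_n) :
    set 'rV[R]_n :=
  closure U `\` interior U.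

Definition tangent_vector (R : realType) (n : nat) (S : set 'rV[R]_n)
    (x v : 'rV[R]_n) : Prop :=
  exists c : R -> 'rV[R]_n,
    [/\ c 0 = x, \forall t \near (0 : R), S (c t) & is_derive (0 : R) 1 c v].

Definition outward_unit_normal (R : realType) (n : nat) (U : set 'rV[R]_n)
    (x nu : 'rV[R]_n) : Prop :=
  [/\ enorm nu = 1,
      forall v, tangent_vector (boundary U) x v -> dotv v nu = 0 &
      \forall t \near (0 : R)^'+, ~ closure U (x + t *: nu)].

(* Directional derivative at a boundary point, computed with the continuous
   extension of the gradient (f is arbitrary outside closure U). *)
Definition bd_derive (R : realType) (n : nat) (U : set 'rV[R]_n)
    (f : 'rV[R]_n -> R) (x nu : 'rV[R]_n) : R :=
  dotv (\row_(i < n) ext_val U (partial i f) x) nu.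

(* R^N with N = m + 1: [x = row_mx x' x_N]. *)
Definition last_coord (m : nat) : 'I_(m + 1) := rshift m ord0.

Definition xlast (R : realType) (m : nat) (x : 'rV[R]_(m + 1)) : R :=
  x ord0 (last_coord m).

Definition epigraph (R : realType) (m : nat) (g : 'rV[R]_m -> R) :
    set 'rV[R]_(m + 1) :=
  [set x | g (lsubmx x) < xlast x].

Definition C1_holder (R : realType) (m : nat) (gamma : R) (g : 'rV[R]_m -> R) :
    Prop :=
  [/\ Ck 1 setT g,
      has_ubound (range (fun x => enorm (grad g x))) &
      has_ubound [set enorm (grad g p.1 - grad g p.2)
                        / (enorm (p.1 - p.2)) `^ gamma
                 | p in [set p : 'rV[R]_m * 'rV[R]_m | p.1 != p.2]]].

Definition locally_lipschitz (R : realType) (f : R -> R) : Prop :=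
  forall x : R, exists2 A : set R, nbhs x A & [lipschitz f y | y in A].

(* Main.v *)
Require Import Defs.
From mathcomp Require Import all_boot all_order all_algebra.
From mathcomp Require Import all_classical all_reals all_analysis.
From mathcomp Require Import ring lra.

(** Monotonicity by the method of moving planes, with explicit barriers at the
places where one usually extracts convergent subsequences.

For a level [lam] let x^lam be the mirror image of x in the horizontal
hyperplane of height [lam], and call w(x) = u(x^lam) - u(x) the gap.  If the gap
is nonnegative at the points of the domain below the hyperplane, for every
[lam], then Hopf's boundary lemma for the gap at the hyperplane, where its
vertical derivative is -2 du/dx_N, yields the strict inequality ([hopf]).
For [lam] <= inf g there are no points below the hyperplane, so everything
rests on passing from [lam] to [lam + eps] with an [eps] that depends only on
an upper bound for [lam] ([advance]); finitely many steps then reach any level.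

To advance, cut the region below the hyperplane in two.  Just below the
hyperplane the region lies in a narrow flat strip, in which the maximum
principle holds for the linear inequality satisfied by the gap
([narrow_strip]).  In the rest, the gap is bounded below by a positive constant
that does not depend on the point ([gap_lower_bound]), and since u is Lipschitz
in half spaces a small displacement of the hyperplane cannot destroy that.

The uniform lower bound is where the overdetermined condition enters.  Near
any boundary point P, at any small scale t, there is a boundary point touched
from outside by a ball of radius comparable to t.  At that point the normal
slope is |c|, whereas an exterior barrier would force a smaller slope if u were
much smaller than t around it.  So u >= const * t somewhere within 3t of P
([boundary_growth]).  When the gap is nonnegative, u is at least as large at the
mirror image of that point, which lies within 3t of P^lam.  Now P^lam is
interior, u >= 0 there and the Laplacian of u is bounded, so the curvature can
only contribute order t^2 to u, which cannot cancel a contribution of order t: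
u(P^lam) is bounded below ([reflected_boundary_pos]).  As u(P) = 0, the gap is
bounded below near the whole graph; a quantitative strong maximum principle,
applied along a vertical chain of balls, carries the bound to the remaining
points ([gap_spread]).

Every comparison is an instance of [touching_principle] against a Gaussian
or, in the strip, a polynomial.  The solution is extended by zero below the
graph: the extension is continuous on the whole space and Lipschitz in half
spaces, so that no argument has to follow the boundary. *)

Set Implicit Arguments.
Unset Strict Implicit.
Unset Printing Implicit Defensive.

Import Order.TTheory GRing.Theory Num.Theory.
Import numFieldNormedType.Exports.

Local Open Scope classical_set_scope.
Local Open Scope ring_scope.

(** * Second derivatives on the line *)

Section SecondDerivative.
Variable R : realType.
Implicit Types (phi psi : R -> R) (a b t : R).

(** The second derivative at 0, through a first derivative that is only required
    near 0.  Working with functions of one variable lets barriers be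
    differentiated along coordinate lines, without differentials in space. *)
Definition has_d2 phi a :=
  exists dphi : R -> R, (\forall s \near (0 : R), is_derive (s : R) 1 phi (dphi s)) /\
    is_derive (0 : R) 1 dphi a.

(** With a negative second derivative the first derivative, which vanishes at
    the minimum, would be negative just to the right of 0, and the mean value
    theorem would make the function decrease there. *)
Lemma has_d2_min phi a :
  has_d2 phi a -> (\forall s \near (0 : R), phi 0 <= phi s) -> 0 <= a.
Proof.
move=> [dphi [dphiE d2]] phi_min; rewrite leNgt; apply/negP => a0.
have [r /= r0 hr'] := filterI dphiE phi_min.
have hr s : `|s| < r -> is_derive (s : R) 1 phi (dphi s) /\ phi 0 <= phi s.
  by move=> sr; apply: hr'; rewrite /ball/= sub0r normrN.
have inr s : s \in `]-r, r[ -> `|s| < r by rewrite in_itv/= ltr_norml.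
have d0 : dphi 0 = 0.
  have h0 : (0 : R) \in `]-r, r[ by rewrite in_itv/= oppr_lt0 r0.
  have /@derive_val <- := (hr 0 (inr _ h0)).1.
  have rr : -r <= r by apply: ltW; apply: gtrN.
  have H1 t : t \in `]-r, r[ -> derivable phi t 1.
    by move=> /inr /hr [h _]; apply: ex_derive.
  have H2 t : t \in `]-r, r[ -> phi 0 <= phi t by move=> /inr /hr [].
  by have /@derive_val := derive1_at_min rr H1 h0 H2.
have := @ex_derive _ _ _ _ _ _ _ d2; have := @derive_val _ _ _ _ _ _ _ d2.
rewrite /derive => aE cv.
have {}cv : h^-1 *: (dphi h) @[h --> (0:R)^'] --> a.
  rewrite -aE; apply: cvg_trans cv; apply: near_eq_cvg.
  by near=> h; rewrite /= /shift/= addr0 d0 subr0 [h *: 1]mulr1.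
have [e' /= e'0 he'] := @cvgr_lt _ _ _ _ _ _ cv _ a0.
have [h [h0 h_r he2]] : exists h : R, [/\ 0 < h, h < r & h < e'].
  exists (Num.min r e' / 2).
  have m0 : 0 < Num.min r e' by rewrite lt_min r0.
  have : Num.min r e' / 2 < Num.min r e' by rewrite ltr_pdivrMr// ltr_pMr// ltr1n.
  by rewrite lt_min => /andP[-> ->]; rewrite divr_gt0.
have neg s : 0 < s -> s < e' -> dphi s < 0.
  move=> s0 se; have := he' s; rewrite /= sub0r normrN gtr0_norm//.
  move=> /(_ se (lt0r_neq0 s0)).
  by rewrite /GRing.scale/= pmulr_rlt0// invr_gt0.
have dr x : x \in `]0, h[ -> is_derive (x : R) 1 phi (dphi x).
  rewrite in_itv/= => /andP[x0 xh].
  by apply: (hr x _).1; rewrite gtr0_norm//; apply: lt_trans xh h_r.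
have ct : {within `[0, h], continuous phi}.
  apply: derivable_within_continuous => x.
  rewrite in_itv/= => /andP[x0 xh]; apply: @ex_derive.
  by apply: (hr x _).1; rewrite ger0_norm//; apply: le_lt_trans xh h_r.
have [c + cE] := MVT h0 dr ct; rewrite in_itv/= => /andP[c0 ch].
have := (hr h _).2; rewrite gtr0_norm// => /(_ h_r).
rewrite -subr_ge0 cE subr0 leNgt => /negP; apply.
by rewrite nmulr_rlt0// neg// (lt_trans ch).
Unshelve. all: by end_near. Qed.

Lemma has_d2_lin phi psi t a b : has_d2 phi a -> has_d2 psi b ->
  has_d2 (fun s => phi s + t * psi s) (a + t * b).
Proof.
move=> [dp [hp hp2]] [dq [hq hq2]].
exists (fun s => dp s + t * dq s); split; last first.
  by apply: is_deriveD; apply: is_deriveZ.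
near=> s; apply: is_deriveD; first by near: s.
by apply: is_deriveZ; near: s.
Unshelve. all: by end_near. Qed.

Lemma has_d2_near phi psi a : (\forall s \near (0 : R), phi s = psi s) ->
  has_d2 phi a -> has_d2 psi a.
Proof.
move=> /nbhs_interior eq_pp [dp [hp hp2]]; exists dp; split => //.
near=> s; apply: (@near_eq_is_derive _ _ _ phi); last by near: s.
by near: s; apply: eq_pp.
Unshelve. all: by end_near. Qed.

Lemma has_d2_opp phi a : has_d2 phi a -> has_d2 (fun s => phi (- s)) a.
Proof.
move=> [dp [hp hp2]].
have near0N (P : set R) : (\forall s \near (0:R), P s) -> \forall s \near (0:R), P (- s).
  have : - s @[s --> (0:R)] --> (0:R).
    by rewrite -[X in _ --> X]oppr0; apply: cvgN.
  by move=> + h; apply.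
have dN (q : R -> R) (s c : R) : is_derive (- s) 1 q c -> is_derive (s : R) 1 (fun s => q (- s)) (- c).
  move=> h.
  have -> : (- c) = c * (-1) by rewrite mulrN1.
  apply: (@is_derive1_comp _ q -%R) => //.
exists (fun s => - dp (- s)); split; last first.
  have -> : a = - - a by rewrite opprK.
  by apply: is_deriveN; apply: dN; rewrite oppr0.
by have := near0N _ hp; apply: filterS => s; apply: dN.
Qed.

End SecondDerivative.

Section Quadratic.
Variable R : realType.
Implicit Types a b c s : R.

Lemma is_derive_quadratic a b c s :
  is_derive (s : R) 1 (fun s => c + b * s + a * s ^+ 2) (b + 2 * a * s).
Proof.
have hid := @is_derive_id R R s 1.
have hX := @is_deriveX R R (@id R) 2 s 1 1 hid.
have h := is_deriveD (is_deriveD (@is_derive_cst R R R c s 1) (is_deriveZ b hid))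
  (is_deriveZ a hX).
rewrite (_ : b + _ = 0 + b *: 1 + a *: ((2%:R * s ^+ 1) *: 1)); first exact: h.
by rewrite /GRing.scale/=; ring.
Qed.

Lemma has_d2_quadratic a b c : has_d2 (fun s => c + b * s + a * s ^+ 2) (2 * a).
Proof.
exists (fun s => b + 2 * a * s); split.
  by apply: filterE => s; apply: is_derive_quadratic.
have -> : (fun s => b + 2 * a * s) = (fun s => b + 2 * a * s + 0 * s ^+ 2).
  by apply/funext => s; rewrite mul0r addr0.
by apply: (is_derive_eq (is_derive_quadratic _ _ _ _)); rewrite mulr0 addr0.
Qed.

Lemma has_d2_expR_quadratic a b c :
  has_d2 (fun s => expR (c + b * s + a * s ^+ 2)) ((b ^+ 2 + 2 * a) * expR c).
Proof.
pose q s := c + b * s + a * s ^+ 2; pose q' s := b + 2 * a * s.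
have dE s : is_derive (s : R) 1 (fun s => expR (q s)) (expR (q s) * q' s).
  apply: (@is_derive1_comp _ expR q); exact: is_derive_quadratic.
exists (fun s => expR (q s) * q' s); split; first exact: filterE.
have dq' : is_derive (0 : R) 1 q' (2 * a).
  have -> : q' = (fun s => b + 2 * a * s + 0 * s ^+ 2).
    by apply/funext => s; rewrite /q' mul0r addr0.
  by apply: (is_derive_eq (is_derive_quadratic _ _ _ _)); rewrite mulr0 addr0.
apply: (is_derive_eq (is_deriveM (dE 0) dq')).
rewrite /GRing.scale/= /q /q' !mulr0 expr0n/= mulr0 !addr0; ring.
Qed.

End Quadratic.

(** * Laplacians along coordinate lines *)

Section LaplacianAt.
Variables (R : realType) (n : nat).
Implicit Types (F H : 'rV[R]_n -> R) (x y z : 'rV[R]_n) (i k : 'I_n).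

Definition line F x i (s : R) := F (x + s *: delta_mx ord0 i).

Definition lap_at F x (a : R) :=
  exists D : 'I_n -> R, (forall i, has_d2 (line F x i) (D i)) /\ a = \sum_i D i.

Lemma line_cvg x i : x + s *: delta_mx ord0 i @[s --> (0 : R)] --> x.
Proof.
have {2}-> : x = x + 0 *: delta_mx ord0 i by rewrite scale0r addr0.
by apply: cvgD; [exact: cvg_cst | apply: cvgZr_tmp; exact: cvg_id].
Qed.

Lemma lap_at_lin F H (t : R) x a b : lap_at F x a -> lap_at H x b ->
  lap_at (fun y => F y + t * H y) x (a + t * b).
Proof.
move=> [D [hD ->]] [E [hE ->]]; exists (fun i => D i + t * E i); split.
  by move=> i; exact: (has_d2_lin t (hD i) (hE i)).
by rewrite big_split mulr_sumr.
Qed.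

Lemma lap_at_near F H x a : (\forall y \near x, F y = H y) ->
  lap_at F x a -> lap_at H x a.
Proof.
move=> FH [D [hD ->]]; exists D; split=> // i.
apply: has_d2_near (hD i).
have /= h := @line_cvg x i _ FH.
exact: h.
Qed.

Lemma lap_at_cst (c : R) x : lap_at (fun=> c) x 0.
Proof.
exists (fun=> 0); split; last by rewrite big1.
move=> i; rewrite (_ : line _ _ _ = (fun s => c + 0 * s + 0 * s ^+ 2)); last first.
  by apply/funext => s; rewrite /line !mul0r !addr0.
by rewrite -[X in has_d2 _ X](mulr0 2); apply: has_d2_quadratic.
Qed.

Lemma lap_at_min F x a :
  lap_at F x a -> (\forall y \near x, F x <= F y) -> 0 <= a.
Proof.
move=> [D [hD ->]] hmin; apply: sumr_ge0 => i _.
apply: has_d2_min (hD i) _.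
have -> : line F x i 0 = F x by rewrite /line scale0r addr0.
have /= h := @line_cvg x i _ hmin.
exact: h.
Qed.

(** Maximum principle in touching form.  If [F] went below [- t0 * phi], the
    quotient [F / phi] would attain a minimum [- t] with [t0 < t]; there
    [F + t * phi] vanishes and has a local minimum, so its Laplacian is
    nonnegative.  Comparing with multiples of [phi], and not only with constants,
    is what makes the principle usable for operators with a zero-order term of
    the wrong sign. *)
Lemma touching_principle (D : set 'rV[R]_n) F (phi : 'rV[R]_n -> R) (t0 : R) :
  compact D -> continuous F -> continuous phi ->
  (forall x, D x -> 0 < phi x) ->
  (forall x, D x -> F x < - t0 * phi x ->
     (\forall y \near x, D y) /\
     forall t, t0 < t -> F x = - t * phi x ->
       exists2 a, a < 0 & lap_at (fun y => F y + t * phi y) x a) ->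
  forall x, D x -> - t0 * phi x <= F x.
Proof.
move=> cD cF cphi phi0 hD x Dx; rewrite leNgt; apply/negP => Fx.
pose q y := F y / phi y.
have cq : {within D, continuous q}.
  apply: continuous_in_subspaceT => y /set_mem Dy.
  have p0 : phi y != 0 by rewrite gt_eqF// phi0.
  exact: (cvgM (cF y) (cvgV p0 (cphi y))).
have [|y /set_mem Dy ymin] := @EVT_min_rV R n q D _ cD cq; first by exists x.
have qy : q y < - t0.
  apply: le_lt_trans (ymin x _) _; first exact: mem_set.
  by rewrite /q ltr_pdivrMr ?phi0.
have Fy : F y = - (- q y) * phi y.
  by rewrite opprK /q divfK// gt_eqF// phi0.
have Fy0 : F y < - t0 * phi y by rewrite Fy opprK ltr_pM2r// phi0.
have [nD /(_ (- q y))] := hD y Dy Fy0.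
rewrite ltrNr => /(_ qy Fy)[a a0 la].
suff : 0 <= a by rewrite leNgt a0.
apply: lap_at_min la _; apply: filterS nD => z Dz.
rewrite Fy opprK mulNr subrr mulNr subr_ge0 -ler_pdivlMr ?phi0//.
exact/ymin/mem_set.
Qed.

Definition sq x := dotv x x.

Lemma sqE x : sq x = \sum_i (x ord0 i) ^+ 2.
Proof. by apply: eq_bigr => i _; rewrite expr2. Qed.

Lemma sq_ge0 x : 0 <= sq x.
Proof. by rewrite sqE sumr_ge0// => i _; rewrite sqr_ge0. Qed.

Lemma sqN x : sq (- x) = sq x.
Proof. by rewrite !sqE; apply: eq_bigr => i _; rewrite mxE sqrrN. Qed.

Lemma sq_coord x i : (x ord0 i) ^+ 2 <= sq x.
Proof. by rewrite sqE (bigD1 i)//= lerDl sumr_ge0// => j _; rewrite sqr_ge0. Qed.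

Lemma sq_line x i s :
  sq (x + s *: delta_mx ord0 i) = sq x + 2 * x ord0 i * s + s ^+ 2.
Proof.
rewrite !sqE (bigD1 i)//= [in RHS](bigD1 i)//=.
rewrite !mxE !eqxx/= mulr1 (eq_bigr (fun j => x ord0 j ^+ 2)); first by ring.
by move=> j ji; rewrite !mxE (negbTE ji) andbF/= mulr0 addr0.
Qed.

Lemma norm_coord x i : `|x ord0 i| <= `|x|.
Proof.
rewrite [leRHS]/Num.norm /= mx_normrE; apply/bigmax_geP; right => /=.
by exists (ord0, i).
Qed.

Lemma norm_le x (r : R) : 0 <= r -> (forall i, `|x ord0 i| <= r) -> `|x| <= r.
Proof.
move=> r0 h; rewrite [leLHS]/Num.norm /= mx_normrE; apply/bigmax_leP; split=> //.
by move=> [a b] _ /=; rewrite (ord1 a).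
Qed.

Lemma norm_lt x (r : R) : 0 < r -> (forall i, `|x ord0 i| < r) -> `|x| < r.
Proof.
move=> r0 h; rewrite [ltLHS]/Num.norm /= mx_normrE; apply/bigmax_ltP; split=> //.
by move=> [a b] _ /=; rewrite (ord1 a).
Qed.

Lemma sq_le_norm x (r : R) : 0 <= r -> sq x <= r ^+ 2 -> `|x| <= r.
Proof.
move=> r0 h; apply: norm_le => // i.
rewrite -(@ler_pXn2r _ 2)// ?nnegrE// real_normK ?num_real//.
exact: le_trans (sq_coord _ _) h.
Qed.

Lemma sq_lt_norm x (r : R) : 0 < r -> sq x < r ^+ 2 -> `|x| < r.
Proof.
move=> r0 h; apply: norm_lt => // i.
rewrite -(@ltr_pXn2r _ 2)// ?nnegrE ?(ltW r0)// real_normK ?num_real//.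
exact: le_lt_trans (sq_coord _ _) h.
Qed.

Lemma norm_sq x (r : R) : `|x| <= r -> sq x <= n%:R * r ^+ 2.
Proof.
move=> h; rewrite sqE.
have -> : n%:R * r ^+ 2 = \sum_(i < n) r ^+ 2 by rewrite sumr_const card_ord mulr_natl.
apply: ler_sum => i _.
have r0 : 0 <= r by apply: le_trans h.
rewrite -(real_normK (num_real (x ord0 i))) ler_pXn2r ?nnegrE//.
exact: le_trans (norm_coord _ _) h.
Qed.

Lemma near_norm (x : 'rV[R]_n) (P : set 'rV[R]_n) :
  nbhs x P <-> exists2 e : R, 0 < e & forall y, `|x - y| < e -> P y.
Proof.
split=> [/nbhs_ballP[e /= e0 he]|[e e0 he]].
  by exists e => // y xy; apply: he; rewrite -ball_normE.
apply/nbhs_ballP; exists e => //= y; rewrite -ball_normE; exact: he.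
Qed.

Lemma continuous_addf F H : continuous F -> continuous H -> continuous (fun x => F x + H x).
Proof. by move=> hF hH x; exact: (cvgD (hF x) (hH x)). Qed.

Lemma continuous_oppf F : continuous F -> continuous (fun x => - F x).
Proof. by move=> hF x; exact: (cvgN (hF x)). Qed.

Lemma continuous_mulf F H : continuous F -> continuous H -> continuous (fun x => F x * H x).
Proof. by move=> hF hH x; exact: (cvgM (hF x) (hH x)). Qed.

Lemma continuous_cstf (c : R) : continuous (fun x : 'rV[R]_n => c).
Proof. exact: cst_continuous. Qed.

Lemma coord_cont i : continuous (fun x => x ord0 i : R).
Proof. exact: coord_continuous. Qed.

Lemma sqB_cont z : continuous (fun x => sq (x - z)).
Proof.
rewrite /sq /dotv; elim: (index_enum _) => [|i r IH].
  rewrite (_ : (fun x => _) = (fun=> 0)); first exact: continuous_cstf.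
  by apply/funext => x; rewrite big_nil.
rewrite (_ : (fun x => _) = (fun x => (x ord0 i + - z ord0 i) * (x ord0 i + - z ord0 i)
    + \sum_(j <- r) (x - z) ord0 j * (x - z) ord0 j)).
  have h : continuous (fun x => x ord0 i + - z ord0 i).
    by apply: continuous_addf; [exact: coord_cont | exact: continuous_cstf].
  by apply: continuous_addf => //; apply: continuous_mulf.
by apply/funext => x; rewrite big_cons !mxE.
Qed.

Lemma sq_cont : continuous sq.
Proof.
rewrite (_ : sq = fun x => sq (x - 0)); first exact: sqB_cont.
by apply/funext => x; rewrite subr0.
Qed.

Definition gauss (al : R) z x := expR (- al * sq (x - z)).

Lemma gauss_cont al z : continuous (gauss al z).
Proof.
move=> x; apply: (@continuous_comp _ _ _ (fun x => - al * sq (x - z)) expR); last exact: continuous_expR.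
by apply: continuous_mulf; [exact: continuous_cstf | exact: sqB_cont].
Qed.

Lemma gauss_gt0 al z x : 0 < gauss al z x.
Proof. exact: expR_gt0. Qed.

Lemma lap_at_gauss al z x :
  lap_at (gauss al z) x
    ((4 * al ^+ 2 * sq (x - z) - 2 * n%:R * al) * gauss al z x).
Proof.
exists (fun i => ((- al * (2 * (x - z) ord0 i)) ^+ 2 + 2 * - al) * gauss al z x).
split=> [i|].
  have := has_d2_expR_quadratic (- al) (- al * (2 * (x - z) ord0 i)) (- al * sq (x - z)).
  congr (has_d2 _ _); apply/funext => s; rewrite /line /gauss [x + _ - z]addrAC sq_line.
  by congr expR; ring.
rewrite -mulr_suml big_split/= sumr_const card_ord; congr (_ * _).
rewrite [in LHS]sqE mulr_sumr; congr (_ + _); last by rewrite -mulr_natl; ring.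
by apply: eq_bigr => i _; ring.
Qed.

(** A parabola in the vertical variable, positive in a strip around height [mu],
    times a function growing at infinity in the other variables: the growth
    confines comparison with bounded functions to a compact part of the
    unbounded strip. *)
Definition strip_bar k (mu h0 : R) x :=
  (h0 - (x ord0 k - mu) ^+ 2) * (1 + (sq x - (x ord0 k) ^+ 2)).

Lemma strip_bar_cont k mu h0 : continuous (strip_bar k mu h0).
Proof.
have c2 (c : R) : continuous (fun x => (x ord0 k - c) ^+ 2).
  rewrite (_ : (fun x => _) = (fun x => (x ord0 k + - c) * (x ord0 k + - c))).
    have h : continuous (fun x => x ord0 k + - c).
      by apply: continuous_addf; [exact: coord_cont|exact: continuous_cstf].
    exact: continuous_mulf.
  by apply/funext => x; rewrite expr2.
apply: continuous_mulf; first by apply: continuous_addf; [exact: continuous_cstf | exact/continuous_oppf/c2].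
apply: continuous_addf; first exact: continuous_cstf.
apply: continuous_addf; first exact: sq_cont.
rewrite (_ : (fun x => _) = (fun x => - (x ord0 k - 0) ^+ 2)); first exact/continuous_oppf/c2.
by apply/funext => x; rewrite subr0.
Qed.

Lemma lap_at_strip_bar k mu h0 x :
  lap_at (strip_bar k mu h0) x
    (- 2 * (1 + (sq x - (x ord0 k) ^+ 2)) +
     2 * n.-1%:R * (h0 - (x ord0 k - mu) ^+ 2)).
Proof.
set Q := 1 + _; set P := h0 - _.
exists (fun i => 2 * (if i == k then - Q else P)); split=> [i|].
  have [->|ik] := eqVneq i k.
    have := has_d2_quadratic (- Q) (- 2 * (x ord0 k - mu) * Q) (P * Q).
    congr (has_d2 _ _); apply/funext => s; rewrite /line /strip_bar sq_line !mxE !eqxx/=.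
    by rewrite /P /Q; ring.
  have := has_d2_quadratic P (2 * x ord0 i * P) (P * Q).
  congr (has_d2 _ _); apply/funext => s; rewrite /line /strip_bar sq_line !mxE !eqxx/=.
  by rewrite (eq_sym k) (negbTE ik)/= mulr0 addr0 /P /Q; ring.
rewrite (bigD1 k)//= eqxx (eq_bigr (fun=> 2 * P)); last by move=> i /negbTE ->.
rewrite sumr_const cardC1 card_ord -[_ *+ _]mulr_natl; ring.
Qed.

Definition mirror k (lam : R) x := x + (2 * (lam - x ord0 k)) *: delta_mx ord0 k.

Lemma mirror_coord k lam x : (mirror k lam x) ord0 k = 2 * lam - x ord0 k.
Proof. by rewrite !mxE !eqxx/=; ring. Qed.

Lemma mirror_other k lam x i : i != k -> (mirror k lam x) ord0 i = x ord0 i.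
Proof. by move=> ik; rewrite !mxE (negbTE ik) andbF/= mulr0 addr0. Qed.

Lemma mirror_norm k lam x y : `|mirror k lam x - mirror k lam y| <= `|x - y|.
Proof.
apply: norm_le => // i; apply: le_trans (norm_coord (x - y) i).
rewrite [X in `|X|]mxE [X in `|_ + X|]mxE [X in _ <= `|X|]mxE [X in _ <= `|_ + X|]mxE.
have [->|ik] := eqVneq i k; last by rewrite !mirror_other.
rewrite !mirror_coord (_ : _ - _ = - (x ord0 k - y ord0 k)) ?normrN//; ring.
Qed.

Lemma mirror_cont k lam : continuous (mirror k lam).
Proof.
move=> x A /near_norm[e e0 he]; apply/near_norm; exists e => // y xy; apply: he.
by apply: le_lt_trans xy; exact: mirror_norm.
Qed.

Lemma lap_at_mirror F k lam x a :
  lap_at F (mirror k lam x) a -> lap_at (fun y => F (mirror k lam y)) x a.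
Proof.
move=> [D [hD ->]]; exists D; split=> // i.
have mline s : mirror k lam (x + s *: delta_mx ord0 i) = mirror k lam x +
    (if i == k then - s else s) *: delta_mx ord0 i.
  apply/rowP => j; have [->|jk] := eqVneq j k.
    rewrite mirror_coord [in RHS]mxE mirror_coord !mxE eqxx/=.
    by have [_|_] := eqVneq i k => /=; ring.
  rewrite mirror_other// [in RHS]mxE mirror_other// !mxE.
  by have [->|_] := eqVneq i k; rewrite ?(negbTE jk)//=; ring.
rewrite (_ : line _ _ _ = fun s => line F (mirror k lam x) i (if i == k then - s else s)).
  by have [ik|ik] := eqVneq i k; [exact: (has_d2_opp (hD i))|exact: hD].
by apply/funext => s; rewrite /line mline.
Qed.

End LaplacianAt.

(** * Gaussian barriers *)

Section Barriers.
Variables (R : realType) (n : nat).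
Implicit Types (F W : 'rV[R]_n -> R) (x y z : 'rV[R]_n).

Lemma near_lt F x (c : R) : continuous F -> F x < c -> nbhs x [set y | F y < c].
Proof. by move=> cF Fx; apply: (@cvgr_lt _ _ _ _ _ _ (cF x) _ Fx). Qed.

Lemma near_gt F x (c : R) : continuous F -> c < F x -> nbhs x [set y | c < F y].
Proof. by move=> cF Fx; apply: (@cvgr_gt _ _ _ _ _ _ (cF x) _ Fx). Qed.

Lemma closed_lef F (c : R) : continuous F -> closed [set x | F x <= c].
Proof.
move=> cF; apply: (@closed_comp _ _ F [set y : R | y <= c]) => [x _|].
  exact: cF.
exact: closed_le.
Qed.

Lemma closed_gef F (c : R) : continuous F -> closed [set x | c <= F x].
Proof.
move=> cF; apply: (@closed_comp _ _ F [set y : R | c <= y]) => [x _|].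
  exact: cF.
exact: closed_ge.
Qed.

Lemma compact_in_ball (D : set 'rV[R]_n) z (r : R) :
  closed D -> (forall x, D x -> `|x - z| <= r) -> compact D.
Proof.
move=> cD h; apply: bounded_closed_compact => //.
exists (`|z| + r); split; first exact: num_real.
move=> M hM x /h xz; apply: ltW; apply: le_lt_trans hM.
rewrite -(subrK z x) addrC; apply: le_trans (ler_normD _ _) _.
by rewrite lerD2l.
Qed.

Lemma compact_sq_le z (D : set 'rV[R]_n) (r : R) : 0 <= r -> closed D ->
  (forall x, D x -> sq (x - z) <= r ^+ 2) -> compact D.
Proof.
by move=> r0 cD h; apply: (compact_in_ball (z := z) (r := r)) => // x /h; apply: sq_le_norm.
Qed.

Lemma gauss_le al z x (s : R) : 0 < al -> s <= sq (x - z) ->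
  gauss al z x <= expR (- al * s).
Proof. by move=> al0 h; rewrite ler_expR !mulNr lerN2 ler_pM2l. Qed.

Lemma gauss_ge al z x (s : R) : 0 < al -> sq (x - z) <= s ->
  expR (- al * s) <= gauss al z x.
Proof. by move=> al0 h; rewrite ler_expR !mulNr lerN2 ler_pM2l. Qed.

(** A Gaussian is a strict subsolution away from its centre once [al] is large
    compared with the size of the ball.  Truncated to vanish on the outer
    sphere, it stays below a nonnegative supersolution [W] that is at least [b] on the
    inner ball.  With [M = 0] this is a quantitative strong maximum
    principle; with [L = 0] it measures how fast a function with Laplacian
    bounded above can drop to zero. *)
Lemma ball_barrier W z (rr p al L M b : R) :
  continuous W -> 0 <= L -> 0 <= M -> 0 < b -> 0 < al -> 0 <= p ->
  (forall x, sq (x - z) <= p ^+ 2 -> 0 <= W x) ->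
  (forall x, sq (x - z) <= rr -> b <= W x) ->
  (forall x, rr < sq (x - z) -> sq (x - z) < p ^+ 2 ->
     exists2 l, l <= L * W x + M & lap_at W x l) ->
  M < b * expR (- al * p ^+ 2) * (4 * al ^+ 2 * rr - 2 * n%:R * al - L) ->
  forall x, sq (x - z) <= p ^+ 2 ->
    b * (gauss al z x - expR (- al * p ^+ 2)) <= W x.
Proof.
move=> cW L0 M0 b0 al0 p0 W0 Wb Wl hM.
set c := expR _ in hM *; set K := (4 * _ * _ - _ - _) in hM.
have c0 : 0 < c by exact: expR_gt0.
have K0 : 0 < K by move: (le_lt_trans M0 hM); rewrite pmulr_rgt0 ?(mulr_gt0 b0).
pose F y := (W y + (- b) * gauss al z y) + c * b.
suff h x : sq (x - z) <= p ^+ 2 -> - 0 * 1 <= F x.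
  move=> x /h; rewrite /F => h1; rewrite -subr_ge0; lra.
apply: (@touching_principle R n [set x | sq (x - z) <= p ^+ 2] F (fun=> 1) 0).
- apply: (@compact_sq_le z _ p) => //.
  by apply: closed_lef; exact: sqB_cont.
- apply: continuous_addf; last exact: continuous_cstf.
  by apply: continuous_addf => //; apply: continuous_mulf; [exact: continuous_cstf|exact: gauss_cont].
- exact: continuous_cstf.
- by move=> *; exact: ltr01.
move=> y /= yp; rewrite oppr0 mul0r => Fy0.
have gle : gauss al z y <= 1.
  by apply: le_trans (gauss_le al0 (sq_ge0 _)) _; rewrite mulr0 expR0.
have gge : c <= gauss al z y by apply: gauss_ge.
(* On the inner ball the barrier is at most [b <= W]. *)
have y1 : rr < sq (y - z).
  rewrite ltNge; apply/negP => /Wb Wy; move: Fy0; rewrite /F ltNge => /negP; apply.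
  nra.
have y2 : sq (y - z) < p ^+ 2.
  rewrite lt_neqAle yp andbT; apply/eqP => E.
  have := W0 _ yp; move: Fy0; rewrite /F {1}/gauss E -/c; lra.
split.
  have := near_lt (@sqB_cont _ _ z) y2.
  by apply: filterS => v /ltW.
move=> t t0 Fy.
have [l lle lW] := Wl y y1 y2.
have h1 := lap_at_lin (- b) lW (lap_at_gauss al z y).
have h2 := lap_at_lin b h1 (lap_at_cst c y).
have h3 := lap_at_lin t h2 (lap_at_cst 1 y).
eexists; last first.
  have -> : (fun y0 : 'rV_n => F y0 + t * 1) = fun y => W y + - b * gauss al z y + b * c + t * 1.
    by apply/funext => v; rewrite /F (mulrC c).
  exact: h3.
rewrite !mulr0 !addr0.
have Wy : W y <= b * gauss al z y by move: Fy0; rewrite /F; nra.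
have LW : L * W y <= L * (b * gauss al z y) by apply: ler_wpM2l.
have g0 := gauss_gt0 al z y.
have s1 : (4 * al ^+ 2 * rr - 2 * n%:R * al) * gauss al z y <=
   (4 * al ^+ 2 * sq (y - z) - 2 * n%:R * al) * gauss al z y.
  apply: ler_wpM2r; first exact: ltW.
  by rewrite lerD2r; apply: ler_wpM2l; [rewrite mulr_ge0// sqr_ge0|exact: ltW].
have s2 : b * c * K <= b * gauss al z y * K.
  by apply: ler_wpM2r; [exact: ltW|apply: ler_wpM2l => //; exact: ltW].
have s3 : b * ((4 * al ^+ 2 * rr - 2 * n%:R * al) * gauss al z y) <=
   b * ((4 * al ^+ 2 * sq (y - z) - 2 * n%:R * al) * gauss al z y).
  by apply: ler_wpM2l => //; exact: ltW.
have s4 : b * gauss al z y * K =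
    b * ((4 * al ^+ 2 * rr - 2 * n%:R * al) * gauss al z y) - L * (b * gauss al z y).
  by rewrite /K; ring.
move: s3 s2 hM LW lle; rewrite s4.
set A := b * (_ * _); set B := b * (_ * _); set LL := L * (b * _).
rewrite mulNr -/B.
lra.
Qed.

(** The companion bound from above: outside a ball of radius [r] missed by the
    set where [W > 0], a reversed Gaussian vanishing on the sphere of radius [r]
    dominates [W], so that [W] grows at most linearly away from a point at
    which that set touches the ball. *)
Lemma ext_barrier W z (r al th a M : R) :
  continuous W -> 0 < r -> 0 <= M -> 0 < a -> 0 < al ->
  th <= a * (1 - expR (- al * (3 * r ^+ 2))) ->
  (forall x, sq (x - z) <= 4 * r ^+ 2 -> W x <= th) ->
  (forall x, 0 < W x -> r ^+ 2 < sq (x - z)) ->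
  (forall x, 0 < W x -> sq (x - z) < 4 * r ^+ 2 ->
     exists2 l, - M <= l & lap_at W x l) ->
  M < a * expR (- al * (3 * r ^+ 2)) * (4 * al ^+ 2 * r ^+ 2 - 2 * n%:R * al) ->
  forall x, r ^+ 2 <= sq (x - z) -> sq (x - z) <= 4 * r ^+ 2 ->
    W x <= a * (1 - expR (al * r ^+ 2) * gauss al z x).
Proof.
move=> cW r0 M0 a0 al0 hth Wth Wpos Wl hM.
set E := expR (al * _); set K := (4 * _ * _ - _) in hM.
have E0 : 0 < E by exact: expR_gt0.
have e30 := expR_gt0 (- al * (3 * r ^+ 2)).
have E3 : E * expR (- al * (4 * r ^+ 2)) = expR (- al * (3 * r ^+ 2)).
  by rewrite -expRD; congr expR; ring.
have E1 : E * expR (- al * r ^+ 2) = 1.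
  by rewrite -expRD mulNr subrr expR0.
have K0 : 0 < K.
  by move: (le_lt_trans M0 hM); rewrite pmulr_rgt0 ?(mulr_gt0 a0).
pose F y := (a + (- (a * E)) * gauss al z y) + (- 1) * W y.
pose D := [set x | r ^+ 2 <= sq (x - z)] `&` [set x | sq (x - z) <= 4 * r ^+ 2].
suff h x : D x -> - 0 * 1 <= F x.
  move=> x x1 x2; have := h x (conj x1 x2); rewrite /F => h1; rewrite -subr_ge0; lra.
apply: (@touching_principle R n D F (fun=> 1) 0).
- apply: (@compact_sq_le z _ (2 * r)).
  + by rewrite mulr_ge0// ltW.
  + by apply: closedI; [apply: closed_gef|apply: closed_lef]; exact: sqB_cont.
  + move=> y [_ /= y2]; apply: (le_trans y2); rewrite exprMn; lra.
- apply: continuous_addf; last by apply: continuous_mulf => //; exact: continuous_cstf.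
  apply: continuous_addf; first exact: continuous_cstf.
  by apply: continuous_mulf; [exact: continuous_cstf|exact: gauss_cont].
- exact: continuous_cstf.
- by move=> *; exact: ltr01.
move=> y [/= y1 y2]; rewrite oppr0 mul0r => Fy0.
have g0 := gauss_gt0 al z y.
have gle : E * gauss al z y <= 1.
  by rewrite -E1; apply: ler_wpM2l; [exact: ltW|apply: gauss_le].
have gge : expR (- al * (3 * r ^+ 2)) <= E * gauss al z y.
  by rewrite -E3; apply: ler_wpM2l; [exact: ltW|apply: gauss_ge].
have Wy0 : 0 < W y by move: Fy0; rewrite /F; nra.
have y1' : r ^+ 2 < sq (y - z) by exact: Wpos.
have y2' : sq (y - z) < 4 * r ^+ 2.
  rewrite lt_neqAle y2 andbT; apply/eqP => E'.
  have := Wth _ y2; move: Fy0; rewrite /F {1}/gauss E'.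
  have : a * E * expR (- al * (4 * r ^+ 2)) = a * expR (- al * (3 * r ^+ 2)) by rewrite -E3; ring.
  lra.
split.
  have n1 : nbhs y [set x | r ^+ 2 < sq (x - z)] by exact: (near_gt (@sqB_cont _ _ z) y1').
  have n2 : nbhs y [set x | sq (x - z) < 4 * r ^+ 2] by exact: (near_lt (@sqB_cont _ _ z) y2').
  by apply: filterS2 n1 n2 => v /= v1 v2; split; apply: ltW.
move=> t t0 Fy.
have [l lge lW] := Wl y Wy0 y2'.
have h1 := lap_at_lin (- (a * E)) (lap_at_cst a y) (lap_at_gauss al z y).
have h2 := lap_at_lin (- 1) h1 lW.
have h3 := lap_at_lin t h2 (lap_at_cst 1 y).
eexists; last exact: h3.
rewrite !mulr0 !addr0 add0r.
have s1 : a * E * (K * gauss al z y) <=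
   a * E * ((4 * al ^+ 2 * sq (y - z) - 2 * n%:R * al) * gauss al z y).
  apply: ler_wpM2l; first by rewrite mulr_ge0// ltW.
  apply: ler_wpM2r; first exact: ltW.
  by rewrite lerD2r; apply: ler_wpM2l; [rewrite mulr_ge0// sqr_ge0|exact: ltW].
have s2 : a * expR (- al * (3 * r ^+ 2)) * K <= a * (E * gauss al z y) * K.
  by apply: ler_wpM2r; [exact: ltW|apply: ler_wpM2l => //; exact: ltW].
have s3 : a * (E * gauss al z y) * K = a * E * (K * gauss al z y) by ring.
lra.
Qed.

End Barriers.

Lemma ex_small4 (R : realFieldType) (a b c d : R) :
  0 < a -> 0 < b -> 0 < c -> 0 < d ->
  exists t, [/\ 0 < t, t < a, t < b, t < c & t < d].
Proof.
move=> a0 b0 c0 d0; pose m := Num.min (Num.min a b) (Num.min c d).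
have m0 : 0 < m by rewrite !lt_min a0 b0 c0 d0.
have : m / 2 < m by rewrite ltr_pdivrMr// ltr_pMr// ltr1n.
rewrite {2}/m !lt_min => /andP[/andP[? ?] /andP[? ?]].
by exists (m / 2); split=> //; rewrite divr_gt0.
Qed.

(** The inequality [lap phi + L * phi < 0] for [phi = strip_bar], where [P] is its
    vertical factor, [1 + q] its horizontal one and [m] the number of horizontal
    variables. *)
Lemma strip_bar_supersolution (R : realFieldType) (N L h P q m : R) :
  1 <= N -> 0 < L -> 0 < h -> (2 * N + L) * h < 2 -> 0 < P -> P <= h ->
  0 <= m -> m <= N -> 0 <= q ->
  L * (P * (1 + q)) + (- 2 * (1 + q) + 2 * m * P) < 0.
Proof.
move=> N_ge1 L0 h0 hh P0 Ph m0 mN q0.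
have e1 : m * P <= N * h by apply: ler_pM => //; apply: ltW.
have e2 : L * P <= L * h by rewrite ler_pM2l.
have e3 : L * P * (1 + q) <= L * h * (1 + q) by apply: ler_wpM2r => //; lra.
have e4 : 0 <= N * h * q by rewrite !mulr_ge0//; lra.
have e5 : (2 * N + L) * h * (1 + q) < 2 * (1 + q) by rewrite ltr_pM2r//; lra.
lra.
Qed.

(** * Moving planes above a Lipschitz graph *)

(** The domain is [{d > 0}], where [d] is the height above the graph; [u] vanishes
    below the graph.  Of the overdetermined problem only the slope condition
    [u_slope] at boundary points is retained. *)
Section MovingPlanes.
Variables (R : realType) (n : nat) (k : 'I_n).
Implicit Types (x y z P : 'rV[R]_n) (lam mu s t : R).

Let e : 'rV[R]_n := delta_mx ord0 k.

Variables (d u : 'rV[R]_n -> R) (f : R -> R) (G l0 C : R).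
Hypothesis G1 : 1 <= G.
Hypothesis d_lip : forall x y, `|d x - d y| <= G * `|x - y|.
Hypothesis d_up : forall x s, d (x + s *: e) = d x + s.
Hypothesis d_low : forall x, d x <= x ord0 k - l0.
Hypothesis u_cont : continuous u.
Hypothesis u_out : forall x, d x <= 0 -> u x = 0.
Hypothesis u_pos : forall x, 0 < d x -> 0 < u x.
Hypothesis u_lap : forall x, 0 < d x -> lap_at u x (- f (u x)).
Hypothesis C0 : 0 < C.
Hypothesis u_slope : forall P, d P = 0 -> exists2 nu : 'rV[R]_n, `|nu| <= 1 &
  \forall s \near (0 : R)^'+, C * s <= u (P + s *: nu).

Let N : R := n%:R.

Lemma dim_ge1 : 1 <= N.
Proof. by rewrite /N ler1n; apply: leq_ltn_trans (ltn_ord k). Qed.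

Lemma G_gt0 : 0 < G. Proof. by apply: lt_le_trans G1. Qed.

Lemma u_ge0 x : 0 <= u x.
Proof. by have [/u_out ->|/u_pos/ltW] := leP (d x) 0. Qed.

Lemma u_pos_d x : 0 < u x -> 0 < d x.
Proof. by move=> h; rewrite ltNge; apply/negP => /u_out E; rewrite E ltxx in h. Qed.

Lemma d_cont : continuous d.
Proof.
move=> x A /nbhs_ballP[r /= r0 hr]; apply/near_norm; exists (r / G).
  by rewrite divr_gt0// G_gt0.
move=> y xy; apply: hr; rewrite /ball/=; apply: le_lt_trans (d_lip _ _) _.
by rewrite mulrC -ltr_pdivlMr// G_gt0.
Qed.

Lemma d_near x y (r : R) : `|x - y| <= r -> d y - G * r <= d x <= d y + G * r.
Proof.
move=> h; have := le_trans (d_lip x y) (ler_wpM2l (ltW G_gt0) h).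
by rewrite ler_norml; lra.
Qed.

Lemma coord_near x y (r : R) : `|x - y| <= r ->
  y ord0 k - r <= x ord0 k <= y ord0 k + r.
Proof.
move=> h; have := le_trans (norm_coord (x - y) k) h.
by rewrite !mxE ler_norml; lra.
Qed.

Lemma up_coord x s : (x + s *: e) ord0 k = x ord0 k + s.
Proof. by rewrite !mxE !eqxx/= mulr1. Qed.

Lemma norm_e s : `|s *: e| = `|s|.
Proof.
apply/eqP; rewrite eq_le; apply/andP; split.
  apply: norm_le => // i; rewrite !mxE eqxx/= normrM.
  by case: (i == k); rewrite ?normr1 ?mulr1// normr0 mulr0.
by have := norm_coord (s *: e) k; rewrite !mxE !eqxx/= mulr1.
Qed.

Lemma d_mirror lam x : d (mirror k lam x) = d x + 2 * (lam - x ord0 k).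
Proof. exact: d_up. Qed.

Lemma mirror_up lam x s : mirror k lam (x + s *: e) = mirror k lam x + (- s) *: e.
Proof.
rewrite /mirror up_coord -/e -!addrA -!scalerDl.
by congr (x + _ *: e); ring.
Qed.

(** Vertical projection onto the graph. *)
Definition foot x := x + (- d x) *: e.

Lemma d_foot x : d (foot x) = 0.
Proof. by rewrite /foot d_up addrN. Qed.

Lemma foot_coord x : (foot x) ord0 k = x ord0 k - d x.
Proof. by rewrite up_coord. Qed.

(** Constants valid in the half space below height [T]; heights of points and of
    their mirror images stay below [T]. *)
Variables (T K M L : R).
Hypothesis K0 : 0 < K.
Hypothesis M0 : 0 < M.
Hypothesis L0 : 0 < L.
Hypothesis u_lip : forall x y, x ord0 k < T -> y ord0 k < T ->
  `|u x - u y| <= K * `|x - y|.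
Hypothesis f_bound : forall x, x ord0 k < T -> `|f (u x)| <= M.
Hypothesis f_lip : forall x y, x ord0 k < T -> y ord0 k < T ->
  `|f (u x) - f (u y)| <= L * `|u x - u y|.

Lemma u_near x y (r : R) : x ord0 k < T -> y ord0 k < T -> `|x - y| <= r ->
  u y - K * r <= u x.
Proof.
move=> xT yT h; have := le_trans (u_lip xT yT) (ler_wpM2l (ltW K0) h).
by rewrite ler_norml; lra.
Qed.

Lemma u_depth x : 0 <= d x -> x ord0 k < T -> u x <= K * d x.
Proof.
move=> dx xT.
have fT : (foot x) ord0 k < T by rewrite foot_coord; lra.
have := u_near (r := d x) fT xT; rewrite (u_out (x := foot x)) ?d_foot//.
rewrite /foot addrAC subrr add0r norm_e normrN ger0_norm// => /(_ (lexx _)); lra.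
Qed.

(** An exterior ball touching the graph near [P]: its centre lies at distance
    [t] straight below [P], and it touches the graph at the point of the closed
    domain nearest to the centre.  The Lipschitz bound on [d] keeps the radius
    comparable to [t]. *)
Lemma nearest_boundary P t : d P = 0 -> 0 < t -> exists p r,
  [/\ d p = 0, 0 < r, t / G <= r <= t, sq (p - (P + (- t) *: e)) = r ^+ 2 &
   forall x, 0 < d x -> r ^+ 2 < sq (x - (P + (- t) *: e))].
Proof.
move=> dP t0; set z := P + _.
have dz : d z = - t by rewrite /z d_up dP add0r.
pose S := [set x | 0 <= d x] `&` [set x | sq (x - z) <= t ^+ 2].
have sqPz : sq (P - z) = t ^+ 2.
  rewrite /z opprD addrA subrr add0r sqN -[_ *: e]add0r sq_line.
  by rewrite mxE mulr0 mul0r addr0 sqrrN sqE big1 ?add0r// => i _; rewrite mxE expr0n.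
have cS : compact S.
  apply: (@compact_sq_le _ _ z _ t); first exact: ltW.
    by apply: closedI; [apply: closed_gef; exact: d_cont|apply: closed_lef; exact: sqB_cont].
  by move=> x [].
have [|p /set_mem[/= dp pt] pmin] := @EVT_min_rV R n (fun x => sq (x - z)) S _ cS
    (continuous_subspaceT (@sqB_cont _ _ z)).
  by exists P; split => /=; rewrite ?dP// sqPz.
have sq0 := sq_ge0 (p - z).
pose r := Num.sqrt (sq (p - z)).
have r2 : r ^+ 2 = sq (p - z) by rewrite sqr_sqrtr.
have r0 : 0 <= r by exact: sqrtr_ge0.
have rt : r <= t by rewrite -(@ler_pXn2r _ 2)// ?nnegrE ?(ltW t0)// r2.
have rG : t / G <= r.
  rewrite ler_pdivrMr ?G_gt0//.
  have /d_near : `|p - z| <= r by apply: sq_le_norm => //; rewrite r2.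
  by rewrite dz; move: dp; lra.
have rpos : 0 < r by apply: lt_le_trans rG; rewrite divr_gt0// G_gt0.
have key x : 0 < d x -> r ^+ 2 < sq (x - z).
  (* Moving an interior point slightly towards [z] stays inside the domain and
     shortens the distance. *)
  move=> dx; rewrite ltNge; apply/negP => xr.
  have /near_norm[q q0 hq] := near_gt d_cont dx.
  have [s [s0 s1 s2 _ _]] := @ex_small4 R 1 (q / (1 + `|z - x|)) 1 1 ltr01
    (divr_gt0 q0 (ltr_wpDr (normr_ge0 _) ltr01)) ltr01 ltr01.
  have n0 : 0 < 1 + `|z - x| by rewrite ltr_wpDr.
  have dy : 0 < d (x + s *: (z - x)).
    apply: hq; rewrite opprD addrA subrr add0r normrN normrZ gtr0_norm//.
    move: s2; rewrite ltr_pdivlMr//; have := normr_ge0 (z - x); nra.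
  have sy : sq (x + s *: (z - x) - z) = (1 - s) ^+ 2 * sq (x - z).
    have -> : x + s *: (z - x) - z = (1 - s) *: (x - z).
      rewrite scalerBl scale1r addrAC; congr (_ + _).
      by rewrite -scalerN opprB.
    by rewrite !sqE mulr_sumr; apply: eq_bigr => i _; rewrite mxE exprMn.
  have x2 : 0 < sq (x - z).
    rewrite lt_neqAle sq_ge0 andbT eq_sym; apply/eqP => E.
    have /d_near : `|x - z| <= 0 by apply: sq_le_norm => //; rewrite E expr0n.
    by rewrite dz; move: dx; lra.
  have lt1 : (1 - s) ^+ 2 * sq (x - z) < sq (x - z).
    by rewrite gtr_pMl//; nra.
  have := pmin (x + s *: (z - x)).
  rewrite -r2 sy => h.
  have : r ^+ 2 <= (1 - s) ^+ 2 * sq (x - z).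
    apply: h; apply/mem_set; split => /=; first exact: ltW.
    rewrite sy; apply: (le_trans (ltW lt1)); apply: (le_trans xr).
    by rewrite r2.
  by lra.
exists p, r; split=> //; last by rewrite rG rt.
apply/eqP; rewrite eq_le dp andbT leNgt; apply/negP => /key.
by rewrite r2 ltxx.
Qed.

Let kappa := C / (8 * N ^+ 2).

Lemma kappa_gt0 : 0 < kappa.
Proof. by have := dim_ge1; rewrite /kappa => h; rewrite divr_gt0// mulr_gt0// exprn_gt0//; lra. Qed.

(** If [u <= kappa * r] on the ball of radius [2 * r] around the centre of the
    exterior ball of radius [r], then [ext_barrier] with [al = n / r^2] makes the
    slope of [u] at the touching point at most [3 * C / 4], against [u_slope]. *)
Lemma boundary_growth P t : d P = 0 -> 0 < t ->
  P ord0 k + 3 * t < T -> t < C * expR (- (3 * N)) / (2 * M) ->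
  exists y, `|y - P| <= 3 * t /\ kappa / G * t < u y.
Proof.
move=> dP t0 PT tM.
have dim_ge1 := dim_ge1; have kap0 := kappa_gt0; have G_gt0 := G_gt0.
have [p [r [dp r0 /andP[tr rt] pr hout]]] := nearest_boundary dP t0.
set z := P + _ in pr hout.
have near_P y : sq (y - z) <= 4 * r ^+ 2 -> `|y - P| <= 3 * t.
  move=> h.
  have h1 : `|y - z| <= 2 * r by apply: sq_le_norm; [lra|rewrite exprMn; lra].
  have -> : y - P = (y - z) + (z - P) by rewrite addrA subrK.
  apply: le_trans (ler_normD _ _) _.
  have -> : z - P = (- t) *: e by rewrite /z addrAC subrr add0r.
  by rewrite norm_e normrN gtr0_norm//; lra.
have inT y : sq (y - z) <= 4 * r ^+ 2 -> y ord0 k < T.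
  by move=> /near_P/coord_near; lra.
apply: contrapT => hno.
have small y : sq (y - z) <= 4 * r ^+ 2 -> u y <= kappa * r.
  move=> hy; rewrite leNgt; apply/negP => uy; apply: hno.
  exists y; split; first exact: near_P.
  apply: le_lt_trans uy; rewrite -mulrA; apply: ler_wpM2l; first exact: ltW.
  by rewrite mulrC.
pose al := N / r ^+ 2.
have r20 : 0 < r ^+ 2 by rewrite exprn_gt0.
have alr : al * r ^+ 2 = N by rewrite /al divfK// gt_eqF.
have al0 : 0 < al by rewrite /al divr_gt0//; lra.
have e3 : - al * (3 * r ^+ 2) = - (3 * N) by rewrite -alr; ring.
have E1 : expR (- (3 * N)) <= 1 / 2.
  rewrite expRN -[leRHS]invrK lef_pV2 ?posrE ?expR_gt0 ?invr_gt0 ?divr_gt0//.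
  rewrite div1r invrK; apply: le_trans (expR_ge1Dx _); lra.
have B0 : 0 < expR (- (3 * N)) by exact: expR_gt0.
(* Twice the bound on [u] suffices for the barrier to exceed it on the outer
   sphere, because [exp (- 3 N) <= 1 / 2]. *)
pose a := 2 * (kappa * r).
have a0 : 0 < a by apply: mulr_gt0 => //; apply: mulr_gt0.
have hM : M < a * expR (- al * (3 * r ^+ 2)) * (4 * al ^+ 2 * r ^+ 2 - 2 * n%:R * al).
  rewrite e3.
  have -> : 4 * al ^+ 2 * r ^+ 2 - 2 * n%:R * al = 2 * N ^+ 2 / r ^+ 2.
    rewrite -/N (_ : 4 * al ^+ 2 * r ^+ 2 = 4 * al * (al * r ^+ 2)); last by ring.
    rewrite alr /al; ring.
  have -> : a * expR (- (3 * N)) * (2 * N ^+ 2 / r ^+ 2) =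
      C * expR (- (3 * N)) / (2 * M) * M / r.
    rewrite /a /kappa; field.
    by rewrite !gt_eqF//; lra.
  rewrite ltr_pdivlMr// mulrC ltr_pM2r//.
  by apply: le_lt_trans rt tM.
have hb := @ext_barrier R n u z r al (kappa * r) a M u_cont r0 (ltW M0) a0 al0.
have {}hb x : r ^+ 2 <= sq (x - z) -> sq (x - z) <= 4 * r ^+ 2 ->
    u x <= a * (1 - expR (al * r ^+ 2) * gauss al z x).
  apply: hb => //.
  - rewrite e3 /a; have : 0 < kappa * r by rewrite mulr_gt0.
    nra.
  - by move=> y /u_pos_d /hout.
  - move=> y uy hy; exists (- f (u y)); last exact/u_lap/u_pos_d.
    have := f_bound (inT y (ltW hy)); rewrite ler_norml; lra.
have [nu nu1 hnu] := u_slope dp.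
have sqnu : sq nu <= N by have := norm_sq nu1; rewrite expr1n mulr1.
have dot_nu : `|dotv (p - z) nu| <= N * r.
  rewrite /dotv; apply: le_trans (ler_norm_sum _ _ _) _.
  have -> : N * r = \sum_(i < n) r by rewrite sumr_const card_ord mulr_natl.
  apply: ler_sum => i _; rewrite normrM -[leRHS]mulr1.
  apply: ler_pM => //.
    apply: le_trans (norm_coord _ _) _; apply: sq_le_norm; first exact: ltW.
    by rewrite pr.
  exact: le_trans (norm_coord _ _) nu1.
have sq_exp s : sq (p + s *: nu - z) = r ^+ 2 + 2 * s * dotv (p - z) nu + s ^+ 2 * sq nu.
  rewrite -pr addrAC !sqE /dotv !mulr_sumr -!big_split/=.
  by apply: eq_bigr => i _; rewrite !mxE; ring.
have [s [s0 hs sr]] : exists s, [/\ 0 < s, C * s <= u (p + s *: nu) & s < r / N].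
  near (0 : R)^'+ => s.
  exists s; split.
  - by near: s; exact: nbhs_right_gt.
  - by near: s.
  - by near: s; apply: nbhs_right_lt; rewrite divr_gt0//; lra.
move: dot_nu; rewrite ler_norml => /andP[_ dot_nu].
have sqnu0 := sq_ge0 nu.
move: sr; rewrite ltr_pdivlMr; last by lra.
move=> sN; have sr : s <= r by apply: le_trans (ltW sN); rewrite ler_pMr.
have us : 0 < u (p + s *: nu) by apply: lt_le_trans hs; rewrite mulr_gt0.
have s_lo : r ^+ 2 <= sq (p + s *: nu - z) by apply: ltW; apply: hout; exact: u_pos_d.
have s_hi : sq (p + s *: nu - z) <= r ^+ 2 + 3 * (s * (N * r)).
  rewrite sq_exp.
  have h1 : s * dotv (p - z) nu <= s * (N * r) by rewrite ler_pM2l.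
  have h2 : s ^+ 2 * sq nu <= s * (N * r).
    rewrite expr2 -mulrA ler_pM2l// mulrC; apply: ler_pM => //; exact: ltW.
  lra.
have := hb _ s_lo _; rewrite /gauss -expRD => {}hb.
have {hb} := le_trans hs (hb _).
set q := sq _ in s_lo s_hi *.
have := expR_ge1Dx (al * r ^+ 2 + - al * q) => h1 h2.
have {}h2 : C * s <= a * (al * (q - r ^+ 2)).
  apply: le_trans (h2 _) _.
    by apply: (le_trans s_hi); have : s * (N * r) <= r * r; [rewrite mulrA ler_pM2r// ltW|lra].
  by apply: ler_wpM2l; [exact: ltW|lra].
have h3 : a * (al * (q - r ^+ 2)) <= a * (al * (3 * (s * (N * r)))).
  by apply: ler_wpM2l; [exact: ltW|apply: ler_wpM2l; [exact: ltW|lra]].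
have h4 : a * (al * (3 * (s * (N * r)))) = 3 / 4 * (C * s).
  by rewrite /a /al /kappa; field; rewrite !gt_eqF//; lra.
have : 0 < C * s by rewrite mulr_gt0.
lra.
Unshelve. all: by end_near. Qed.


Variable Lam : R.
Hypothesis l0_Lam : l0 <= Lam.
Hypothesis T_Lam : 2 * Lam - l0 + 1 <= T.

Definition below_mirror lam :=
  forall x, 0 < d x -> x ord0 k < lam -> u x <= u (mirror k lam x).

Lemma mirror_T lam x : lam <= Lam -> 0 <= d x -> (mirror k lam x) ord0 k < T.
Proof. by move=> hl dx; rewrite mirror_coord; have := d_low x; move: T_Lam; lra. Qed.

(** Let [y] be the point near [P] given by [boundary_growth] at scale [t].  Around
    its mirror image [u] is at least [k1 * t / 2] on a ball of radius
    [k2 * t], and [ball_barrier] with [L = 0] transports this to the mirror image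
    of [P], at distance at most [3 * t].  All lengths are proportional to [t], so
    the bound [M] on the Laplacian is negligible once [t] is small. *)
Lemma reflected_boundary_pos (delta : R) : 0 < delta -> exists2 eps : R, 0 < eps &
  forall lam P, lam <= Lam -> below_mirror lam -> d P = 0 ->
    P ord0 k <= lam - delta -> eps <= u (mirror k lam P).
Proof.
move=> delta0; have dim_ge1 := dim_ge1; have kap0 := kappa_gt0; have G_gt0 := G_gt0.
have TL := T_Lam; have lL := l0_Lam.
pose k1 := kappa / G; have k10 : 0 < k1 by rewrite divr_gt0.
pose k2 := k1 / (2 * K); have k20 : 0 < k2 by rewrite divr_gt0// mulr_gt0.
pose A := N / k2 ^+ 2; have A0 : 0 < A by rewrite divr_gt0 ?exprn_gt0//; lra.
pose E := expR (- A * (9 * N + 1)); have E0 : 0 < E by exact: expR_gt0.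
pose Q := 9 * N + 4.
have Q0 : 0 < Q by rewrite /Q; lra.
have [t [t0 t1 t2 t3 t4]] := @ex_small4 R (C * expR (- (3 * N)) / (2 * M))
  (delta / (G * Q)) (1 / (Q + k2)) (k1 * E * N ^+ 2 / (k2 ^+ 2 * M))
  (divr_gt0 (mulr_gt0 C0 (expR_gt0 _)) (mulr_gt0 (ltr0Sn _ 1) M0))
  (divr_gt0 delta0 (mulr_gt0 G_gt0 Q0)) (divr_gt0 ltr01 (addr_gt0 Q0 k20))
  (divr_gt0 (mulr_gt0 (mulr_gt0 k10 E0) (exprn_gt0 _ (lt_le_trans ltr01 dim_ge1)))
    (mulr_gt0 (exprn_gt0 _ k20) M0)).
have tG : G * (Q * t) < delta by move: t2; rewrite ltr_pdivlMr ?mulr_gt0//; lra.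
have k2t : 0 < k2 * t by rewrite mulr_gt0.
have Qt : 0 < Q * t by rewrite mulr_gt0.
have tQ2 : Q * t + k2 * t < 1 by move: t3; rewrite ltr_pdivlMr ?addr_gt0//; lra.
have tQ : Q * t < 1 by lra.
have t34 : 4 * t <= Q * t by rewrite ler_pM2r// /Q; lra.
have QG : Q * t <= G * (Q * t) by rewrite ler_peMl// mulr_ge0// ltW.
pose b := k1 * t / 2; have b0 : 0 < b by rewrite divr_gt0// mulr_gt0.
pose al := A / t ^+ 2; have al0 : 0 < al by rewrite divr_gt0// exprn_gt0.
have t20 : 0 < t ^+ 2 by rewrite exprn_gt0.
have alt (c : R) : - al * (c * t ^+ 2) = - A * c.
  by rewrite /al; field; rewrite gt_eqF.
exists (b * (expR (- A * (9 * N)) - E)).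
  rewrite mulr_gt0// subr_gt0 ltr_expR; lra.
move=> lam P lamL good dP Pk.
have PT : P ord0 k + 3 * t < T by have := d_low P; lra.
have [y [yP uy]] := boundary_growth dP t0 PT t1.
have uy0 : 0 < u y by apply: lt_trans uy; exact: mulr_gt0.
have dy := u_pos_d uy0.
have yk : y ord0 k < lam by have := coord_near yP; lra.
pose Y := mirror k lam y; pose q := mirror k lam P.
have Yq : `|Y - q| <= 3 * t by apply: le_trans (mirror_norm _ _ _ _) _.
have dq : 2 * delta <= d q by rewrite /q d_mirror; lra.
have qk : q ord0 k <= 2 * Lam - l0 by rewrite /q mirror_coord; have := d_low P; lra.
have uY : k1 * t < u Y by apply: (lt_le_trans uy); exact: good.
have YT : Y ord0 k < T by apply: mirror_T => //; exact: ltW.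
(* The outer ball strictly contains the mirror image [q] of [P]: a sup norm of
   [3 * t] allows a squared Euclidean norm of [9 * N * t ^+ 2]. *)
pose p := Num.sqrt (9 * N + 1) * t.
have p2 : p ^+ 2 = (9 * N + 1) * t ^+ 2 by rewrite exprMn sqr_sqrtr//; lra.
have near_q x : sq (x - Y) <= p ^+ 2 -> `|x - q| <= Q * t.
  move=> h; have h1 : `|x - Y| <= (9 * N + 1) * t.
    apply: sq_le_norm; first by rewrite mulr_ge0//; [lra|exact: ltW].
    apply: (le_trans h); rewrite p2 exprMn ler_pM2r// expr2 ler_peMl//; lra.
  have -> : x - q = (x - Y) + (Y - q) by rewrite addrA subrK.
  by apply: le_trans (ler_normD _ _) _; rewrite /Q; lra.
have in_om x : sq (x - Y) <= p ^+ 2 -> 0 < d x /\ x ord0 k < T.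
  move=> /near_q h; have := d_near h; have := coord_near h; lra.
have hb := @ball_barrier R n u Y ((k2 * t) ^+ 2) p al 0 M b u_cont (lexx _) (ltW M0) b0 al0.
have {}hb x : sq (x - Y) <= p ^+ 2 ->
    b * (gauss al Y x - expR (- al * p ^+ 2)) <= u x.
  apply: hb => //.
  - by rewrite mulr_ge0 ?sqrtr_ge0// ltW.
  - by move=> *; exact: u_ge0.
  - move=> v hv.
    have hv' : `|v - Y| <= k2 * t by apply: sq_le_norm => //; rewrite mulr_ge0// ltW.
    have vT : v ord0 k < T.
      have := coord_near hv'; have := d_low y; rewrite /Y mirror_coord.
      by move: T_Lam; lra.
    have := u_near vT YT hv'.
    have -> : K * (k2 * t) = b by rewrite /k2 /b; field; rewrite gt_eqF.
    by rewrite /b; lra.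
  - move=> v _ /ltW /in_om[dv vT]; exists (- f (u v)); last exact: u_lap.
    by rewrite mul0r add0r; have := f_bound vT; rewrite ler_norml; lra.
  - rewrite p2 alt -/E subr0.
    have -> : b * E * (4 * al ^+ 2 * (k2 * t) ^+ 2 - 2 * n%:R * al) =
       k1 * E * N ^+ 2 / (k2 ^+ 2 * M) * M / t.
      by rewrite /b /al /A -/N; field; rewrite !gt_eqF.
    by rewrite ltr_pdivlMr// mulrC ltr_pM2r.
apply: le_trans (hb q _); last first.
  rewrite p2; apply: le_trans (norm_sq (r := 3 * t) _) _; first by rewrite -normrN opprB.
  by rewrite exprMn -/N; nra.
rewrite p2 alt -/E; apply: ler_wpM2l; first exact: ltW.
rewrite lerD2r -alt; apply: gauss_ge => //.
apply: le_trans (norm_sq (r := 3 * t) _) _; first by rewrite -normrN opprB.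
by rewrite exprMn -/N; lra.
Qed.

(** The factor [- 1] gives the gap the shape that [lap_at_lin] produces. *)
Definition gap lam x := u (mirror k lam x) + (- 1) * u x.

Lemma gap_cont lam : continuous (gap lam).
Proof.
apply: continuous_addf; last by apply: continuous_mulf => //; exact: continuous_cstf.
move=> x; apply: (@continuous_comp _ _ _ (mirror k lam) u); last exact: u_cont.
exact: mirror_cont.
Qed.

(** The gap solves a linear inequality because [f] is Lipschitz on the range of
    [u] below height [T]. *)
Lemma gap_lap lam x : lam <= Lam -> 0 < d x -> x ord0 k <= lam ->
  exists2 l, l <= L * `|gap lam x| & lap_at (gap lam) x l.
Proof.
move=> lL dx xl; have TL := T_Lam; have ll := l0_Lam.
have xT : x ord0 k < T by lra.
have mT := mirror_T lL (ltW dx).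
have dm : 0 < d (mirror k lam x) by rewrite d_mirror; lra.
eexists; last exact: (lap_at_lin (- 1) (lap_at_mirror (u_lap dm)) (u_lap dx)).
rewrite /gap mulN1r; apply: le_trans (f_lip mT xT).
rewrite -[X in _ <= X]normrN; apply: le_trans (ler_norm _).
lra.
Qed.

Lemma below_gap lam x : below_mirror lam -> 0 < d x -> x ord0 k < lam ->
  0 <= gap lam x.
Proof. by move=> h dx xl; rewrite /gap mulN1r subr_ge0; exact: h. Qed.

(** Vertically above a boundary point [P], both terms of the gap differ from their
    values 0 and [u (mirror k lam P)] at [P] by at most [K] times the height. *)
Lemma near_graph_gap (delta : R) : 0 < delta -> exists rho eps : R,
  [/\ 0 < rho, 0 < eps & forall lam x, lam <= Lam -> below_mirror lam ->
    0 <= d x -> d x <= rho -> x ord0 k <= lam - delta -> eps <= gap lam x].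
Proof.
move=> delta0; have TL := T_Lam; have ll := l0_Lam.
have [eps e0 he] := reflected_boundary_pos delta0.
exists (eps / (4 * K)), (eps / 2); split.
- by apply: divr_gt0 => //; apply: mulr_gt0.
- exact: divr_gt0.
move=> lam x lL good dx dr xk.
have fk : (foot x) ord0 k <= lam - delta by rewrite foot_coord; lra.
have h1 := he lam (foot x) lL good (d_foot x) fk.
have mT := mirror_T lL dx.
have fT : (mirror k lam (foot x)) ord0 k < T by apply: mirror_T => //; rewrite d_foot.
have h2 : `|mirror k lam x - mirror k lam (foot x)| <= d x.
  apply: le_trans (mirror_norm _ _ _ _) _.
  by rewrite /foot opprD addrA subrr add0r normrN norm_e normrN ger0_norm.
have h3 := u_near mT fT h2.
have h4 : u x <= K * d x by apply: u_depth => //; lra.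
have h5 : K * d x <= eps / 4.
  have -> : eps / 4 = K * (eps / (4 * K)) by field; rewrite gt_eqF.
  by rewrite ler_pM2l.
by rewrite /gap mulN1r; lra.
Qed.

(** One link of a chain of balls: a lower bound on a ball of radius [r] extends,
    up to a fixed factor, to the ball of radius [2 * r]. *)
Lemma gap_spread (r : R) : 0 < r -> r <= 1 -> exists2 chi : R, 0 < chi <= 1 &
  forall lam z (b : R), lam <= Lam -> below_mirror lam -> 0 < b ->
    3 * (G * r) < d z -> z ord0 k + 3 * r < lam ->
    (forall x, sq (x - z) <= r ^+ 2 -> b <= gap lam x) ->
    forall x, sq (x - z) <= 4 * r ^+ 2 -> chi * b <= gap lam x.
Proof.
move=> r0 r1; have dim_ge1 := dim_ge1; have L0' := L0.
pose A := N + L; have A0 : 0 < A by rewrite /A; lra.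
pose E4 := expR (- A * 4); pose E9 := expR (- A * 9).
have E90 : 0 < E9 by exact: expR_gt0.
have E49 : E9 < E4 by rewrite ltr_expR; lra.
have E41 : E4 <= 1 by rewrite -expR0 ler_expR; lra.
exists (E4 - E9); first by rewrite subr_gt0 E49/=; lra.
move=> lam z b lL good b0 dz zk hb x hx.
have r20 : 0 < r ^+ 2 by exact: exprn_gt0.
pose al := A / r ^+ 2; have al0 : 0 < al by exact: divr_gt0.
have alr (c : R) : - al * (c * r ^+ 2) = - A * c by rewrite /al; field; rewrite gt_eqF.
have p2 : (3 * r) ^+ 2 = 9 * r ^+ 2 by rewrite exprMn; lra.
have inom v : sq (v - z) <= (3 * r) ^+ 2 -> 0 < d v /\ v ord0 k < lam.
  move=> hv; have h3 : `|v - z| <= 3 * r by apply: sq_le_norm => //; lra.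
  by have := d_near h3; have := coord_near h3; lra.
have := @ball_barrier R n (gap lam) z (r ^+ 2) (3 * r) al L 0 b (@gap_cont lam)
  (ltW L0) (lexx _) b0 al0.
rewrite p2 alr -/E9 => h.
have {}h : b * (gauss al z x - E9) <= gap lam x.
  apply: h; rewrite -?p2.
  - lra.
  - by move=> v /inom[dv vk]; exact: below_gap.
  - exact: hb.
  - move=> v _ /ltW/inom[dv vk].
    have [l hl lapl] := gap_lap lL dv (ltW vk).
    exists l => //; rewrite addr0; move: hl; rewrite ger0_norm//.
    exact: below_gap.
  - apply: mulr_gt0; first exact: mulr_gt0.
    have -> : 4 * al ^+ 2 * r ^+ 2 - 2 * n%:R * al - L =
       (4 * A ^+ 2 - 2 * N * A) / r ^+ 2 - L.
      by rewrite /al -/N; field; rewrite gt_eqF.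
    rewrite subr_gt0 ltr_pdivlMr//.
    apply: (@le_lt_trans _ _ L).
      by rewrite ler_piMr ?(ltW L0)// expr_le1// ltW.
    rewrite /A; nra.
  - by rewrite p2; lra.
apply: le_trans h; rewrite mulrC; apply: ler_wpM2l; first exact: ltW.
by rewrite lerD2r /E4 -alr; apply: gauss_ge.
Qed.

(** From the layer of height [rho] above the graph, where [near_graph_gap]
    applies, [m] balls of radius [r] climb vertically to any point of the region;
    [m] depends only on the total height available, hence so does the
    constant [chi ^+ m * eps]. *)
Lemma gap_lower_bound (delta : R) : 0 < delta -> exists2 eps : R, 0 < eps &
  forall lam x, lam <= Lam -> below_mirror lam -> 0 < d x ->
    x ord0 k <= lam - delta -> eps <= gap lam x.
Proof.
move=> delta0; have TL := T_Lam; have ll := l0_Lam; have G_gt0 := G_gt0; have G1' := G1.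
have [rho [eps [rho0 eps0 hnear]]] := near_graph_gap delta0.
have [r [r0 r1 r2 r3 _]] := @ex_small4 R 1 (rho / (6 * G)) (delta / 3) 1 ltr01
  (divr_gt0 rho0 (mulr_gt0 (ltr0Sn _ 5) G_gt0)) (divr_gt0 delta0 (ltr0Sn _ 2)) ltr01.
have rG : 6 * (G * r) < rho by move: r2; rewrite ltr_pdivlMr ?mulr_gt0//; lra.
have rrG : r <= G * r by rewrite ler_peMl// ltW.
have [chi /andP[chi0 chi1] hchi] := gap_spread r0 (ltW r1).
pose m := (Num.truncn ((Lam - l0) / r)).+1.
have hm : (Lam - l0) / r < m%:R.
  by apply: truncnS_gt.
have m0 : 0 < (m%:R : R) by rewrite ltr0n.
have hm2 : Lam - l0 < m%:R * r by rewrite -ltr_pdivrMr.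
exists (chi ^+ m * eps); first by apply: mulr_gt0 => //; exact: exprn_gt0.
move=> lam x lL good dx xk.
have chim : chi ^+ m <= 1 by apply: exprn_ile1 => //; exact: ltW.
have [dr|dr] := leP (d x) rho.
  apply: le_trans (hnear _ _ lL good (ltW dx) dr xk).
  by rewrite ler_piMl// ltW.
pose h := (d x - rho / 2) / m%:R.
have h0 : 0 < h by apply: divr_gt0 => //; lra.
have hr : h <= r.
  by rewrite ler_pdivrMr// mulrC; have := d_low x; lra.
have mh : m%:R * h = d x - rho / 2 by rewrite /h mulrC divfK// gt_eqF.
pose z (j : nat) := x + (- (d x - rho / 2 - j%:R * h)) *: e.
have dz j : d (z j) = rho / 2 + j%:R * h by rewrite d_up; lra.
have zk j : (j <= m)%N -> (z j) ord0 k <= x ord0 k.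
  move=> jm; rewrite up_coord; have : j%:R * h <= m%:R * h by rewrite ler_pM2r// ler_nat.
  by lra.
have chain j : (j <= m)%N -> forall y, sq (y - z j) <= r ^+ 2 ->
    chi ^+ j * eps <= gap lam y.
  elim: j => [_ y hy|j IH jm y hy].
    have yz : `|y - z 0%N| <= r by apply: sq_le_norm => //; exact: ltW.
    have := d_near yz; have := coord_near yz; rewrite dz /z up_coord mul0r addr0 subr0.
    move=> /andP[_ h1] /andP[h2 h3]; rewrite expr0 mul1r.
    by apply: hnear => //; lra.
  rewrite exprS -mulrA; apply: (hchi lam (z j)) => //.
  - by apply: mulr_gt0 => //; exact: exprn_gt0.
  - rewrite dz; have : 0 <= j%:R * h by rewrite mulr_ge0// ltW.
    by lra.
  - by have := zk j (ltnW jm); lra.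
  - exact: (IH (ltnW jm)).
  have zS : z j.+1 = z j + h *: e.
    rewrite /z -[RHS]addrA -scalerDl; congr (x + _ *: e).
    by rewrite -natr1; ring.
  have -> : y - z j = (y - z j.+1) + h *: e by move: (z j) (z j.+1) zS => ? ? ->; rewrite opprD addrA subrK.
  rewrite sq_line.
  have vk : `|(y - z j.+1) ord0 k| <= r.
    by apply: le_trans (norm_coord _ _) _; apply: sq_le_norm => //; exact: ltW.
  move: vk; rewrite ler_norml => /andP[_ vk].
  have h1 : (y - z j.+1) ord0 k * h <= r * r.
    by apply: le_trans (_ : r * h <= _); [rewrite ler_pM2r|rewrite ler_pM2l].
  have h2 : h ^+ 2 <= r ^+ 2 by rewrite ler_pXn2r// ?nnegrE ltW.
  by rewrite -mulrA; lra.
apply: (chain m (leqnn _)).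
have -> : z m = x by rewrite /z mh subrr oppr0 scale0r addr0.
by rewrite subrr sqE big1 ?exprn_ge0 ?(ltW r0)// => i _; rewrite mxE expr0n.
Qed.

(** Between the heights [lam - delta] and [mu] the gap is nonnegative on the whole
    boundary and solves [lap w + c(x) * w = 0] with [|c(x)| <= L].  In a narrow strip
    [strip_bar] is a positive strict supersolution of every such equation. *)
Lemma narrow_strip (delta h0 : R) lam mu : mu <= Lam -> 0 < delta -> 0 < h0 ->
  lam - delta <= mu -> (2 * N + L) * h0 < 2 ->
  (mu - (lam - delta)) ^+ 2 <= h0 / 2 ->
  (forall x, 0 < d x -> x ord0 k <= lam - delta -> 0 <= gap mu x) ->
  below_mirror mu.
Proof.
move=> muL delta0 h00 lmu hh hwidth hlow x0 dx0 x0mu.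
have TL := T_Lam; have ll := l0_Lam; have dim_ge1 := dim_ge1; have K0' := K0; have L0' := L0.
rewrite -subr_ge0 -[_ - _]/(u (mirror k mu x0) + - u x0) -mulN1r -/(gap mu x0).
have [x0l|x0l] := leP (x0 ord0 k) (lam - delta); first exact: hlow.
rewrite leNgt; apply/negP => g0.
pose q x := sq x - (x ord0 k) ^+ 2.
have q0 x : 0 <= q x by rewrite subr_ge0 sq_coord.
pose B := K * (Lam - l0) + 1.
have B0 : 0 < B by rewrite /B ltr_wpDl// mulr_ge0 ?subr_ge0// ltW.
pose eta := - gap mu x0; have eta0 : 0 < eta by rewrite oppr_gt0.
(* The squared horizontal radius of the truncation, so large that the values of the
   gap on the lateral boundary cannot account for its value at [x0]. *)
pose rr := q x0 + 2 * B * (1 + q x0) / eta.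
have X0 : 0 <= 2 * B * (1 + q x0) / eta.
  by apply: divr_ge0; [apply: mulr_ge0; [lra|have := q0 x0; lra]|exact: ltW].
have rr0 : 0 <= rr by rewrite /rr addr_ge0.
pose t0 := 2 * B / (h0 * (1 + rr)).
have rr1 : 0 < 1 + rr by lra.
have t00 : 0 <= t0.
  by apply: divr_ge0; [lra|apply: mulr_ge0; [exact: ltW|lra]].
pose phi := strip_bar k mu h0.
pose D := ([set x : 'rV[R]_n | 0 <= d x] `&` [set x : 'rV[R]_n | lam - delta <= x ord0 k])
   `&` ([set x : 'rV[R]_n | x ord0 k <= mu] `&` [set x : 'rV[R]_n | q x <= rr]).
have P_lo x : D x -> h0 / 2 <= h0 - (x ord0 k - mu) ^+ 2.
  case=> [[_ /= h1] [/= h2 _]].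
  have : (x ord0 k - mu) ^+ 2 <= (mu - (lam - delta)) ^+ 2.
    by rewrite -sqrrN ler_pXn2r ?nnegrE//; lra.
  by lra.
have P_hi x : h0 - (x ord0 k - mu) ^+ 2 <= h0.
  by have := sqr_ge0 (x ord0 k - mu); lra.
have phi_lo x : D x -> h0 / 2 * (1 + q x) <= phi x.
  move=> /P_lo h; rewrite /phi /strip_bar -/(q x) ler_pM2r//; have := q0 x; lra.
have phi0 x : D x -> 0 < phi x.
  move=> /phi_lo; apply: lt_le_trans; apply: mulr_gt0; [lra|have := q0 x; lra].
have qc : continuous q.
  apply: continuous_addf; first exact: sq_cont.
  apply: continuous_oppf; rewrite (_ : (fun x => _) = (fun x => x ord0 k * x ord0 k)).
    by apply: continuous_mulf; exact: coord_cont.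
  by apply/funext => x; rewrite expr2.
have g_lo x : 0 <= d x -> x ord0 k <= mu -> - B < gap mu x.
  move=> dx xk; have h1 : u x <= K * d x by apply: u_depth => //; lra.
  have h2 : K * d x <= K * (Lam - l0).
    by apply: ler_wpM2l; [exact: ltW|have := d_low x; lra].
  by rewrite /gap mulN1r /B; have := u_ge0 (mirror k mu x); lra.
have Dx0 : D x0.
  by split; split => /=; [exact: ltW|exact: ltW|exact: ltW|rewrite /rr; lra].
have := @touching_principle R n D (gap mu) phi t0 _ (@gap_cont mu)
  (@strip_bar_cont R n k mu h0) phi0 _ x0 Dx0.
move=> conc.
have {conc} : - t0 * phi x0 <= gap mu x0.
  apply: conc.
    pose c := `|lam - delta| + `|mu|.
    apply: (@compact_sq_le _ _ 0 _ (1 + rr + c ^+ 2)).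
    - by rewrite addr_ge0 ?sqr_ge0// ltW.
    - apply: closedI; apply: closedI.
      + by apply: closed_gef; exact: d_cont.
      + by apply: closed_gef; exact: coord_cont.
      + by apply: closed_lef; exact: coord_cont.
      + exact: closed_lef.
    - move=> x [[_ /= h1] [/= h2 h3]]; rewrite subr0.
      have cx : (x ord0 k) ^+ 2 <= c ^+ 2.
        rewrite -real_normK ?num_real// ler_pXn2r ?nnegrE//; last by rewrite addr_ge0.
        rewrite ler_norml /c; have := ler_norm (- (lam - delta)); have := ler_norm mu.
        rewrite normrN; have := normr_ge0 (lam - delta); have := normr_ge0 mu; lra.
      have : sq x <= rr + c ^+ 2 by move: h3; rewrite /q; lra.
      have := sqr_ge0 c; nra.
  move=> x Dx gx.
  have [[/= dx xl] [/= xm xq]] := Dx.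
  have gx0 : gap mu x < 0.
    by apply: lt_le_trans gx _; rewrite mulNr oppr_le0 mulr_ge0// ltW// phi0.
  have dx1 : 0 < d x.
    rewrite lt_neqAle dx andbT eq_sym; apply/eqP => E.
    move: gx0; rewrite /gap (u_out (x := x)) ?E// mulr0 addr0.
    by have := u_ge0 (mirror k mu x); lra.
  have xm1 : x ord0 k < mu.
    rewrite lt_neqAle xm andbT; apply/eqP => E.
    have mx : mirror k mu x = x by rewrite /mirror E subrr mulr0 scale0r addr0.
    by move: gx0; rewrite /gap mx; lra.
  have xl1 : lam - delta < x ord0 k.
    by rewrite ltNge; apply/negP => /(hlow _ dx1); lra.
  have xq1 : q x < rr.
    rewrite lt_neqAle xq andbT; apply/eqP => E.
    have := phi_lo _ Dx; have := g_lo _ dx xm; rewrite E => h1 h2.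
    have : t0 * (h0 / 2 * (1 + rr)) <= t0 * phi x by apply: ler_wpM2l.
    have -> : t0 * (h0 / 2 * (1 + rr)) = B by rewrite /t0; field; rewrite !gt_eqF.
    by lra.
  split.
    have n1 := near_gt d_cont dx1.
    have n2 := near_gt (@coord_cont R n k) xl1.
    have n3 := near_lt (@coord_cont R n k) xm1.
    have n4 := near_lt qc xq1.
    apply: filterS2 (filterI n1 n2) (filterI n3 n4).
    by move=> v [/= /ltW ? /ltW ?] [/= /ltW ? /ltW ?].
  move=> t tt0 gE.
  have [l hl lapl] := gap_lap muL dx1 xm.
  have lapF := lap_at_lin t lapl (lap_at_strip_bar k mu h0 x).
  eexists; last exact: lapF.
  have t_gt0 : 0 < t by lra.
  have gn : `|gap mu x| = t * phi x by rewrite ltr0_norm// gE mulNr opprK.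
  have {hl}hl : l <= t * (L * phi x) by rewrite mulrCA -gn.
  apply: (@le_lt_trans _ _ (t * (L * phi x + (-2 * (1 + (sq x - x ord0 k ^+ 2)) +
      2 * n.-1%:R * (h0 - (x ord0 k - mu) ^+ 2))))); first by rewrite [leRHS]mulrDr lerD2r.
  rewrite pmulr_rlt0// /phi /strip_bar -/(q x).
  have := P_lo _ Dx; have := P_hi x; have := q0 x.
  move=> hq hP1 hP2; apply: (strip_bar_supersolution dim_ge1 L0 h00 hh _ _ _ _ hq) => //.
  - exact: lt_le_trans (divr_gt0 h00 (ltr0Sn _ 1)) hP2.
  - by rewrite /N ler_nat leq_pred.
have phi_hi : phi x0 <= h0 * (1 + q x0).
  by rewrite /phi /strip_bar -/(q x0) ler_pM2r; [exact: P_hi|have := q0 x0; lra].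
have t1 : t0 * phi x0 <= t0 * (h0 * (1 + q x0)) by apply: ler_wpM2l.
have t2 : t0 * (h0 * (1 + q x0)) = 2 * B * (1 + q x0) / (1 + rr).
  by rewrite /t0; field; rewrite !gt_eqF.
have t3 : 2 * B * (1 + q x0) / (1 + rr) < eta.
  rewrite ltr_pdivrMr//.
  have -> : 2 * B * (1 + q x0) = eta * (2 * B * (1 + q x0) / eta) by field; rewrite gt_eqF.
  by rewrite ltr_pM2l// /rr; have := q0 x0; lra.
by move: t1 t2 t3; rewrite /eta mulNr; lra.
Qed.

(** The step [eps] is such that the hyperplane moves by less than the width
    [delta] of the narrow strip and the gap changes by less than its lower bound
    below that strip. *)
Lemma advance : exists2 eps : R, 0 < eps & forall lam mu, below_mirror lam ->
  lam <= mu -> mu <= lam + eps -> mu <= Lam -> below_mirror mu.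
Proof.
have TL := T_Lam; have ll := l0_Lam; have dim_ge1 := dim_ge1; have K0' := K0; have L0' := L0.
pose h0 := 1 / (2 * N + L).
have c0 : 2 < 2 * N + L by lra.
have h00 : 0 < h0 by apply: divr_gt0; lra.
have h01 : h0 < 1 / 2 by rewrite /h0 ltr_pdivrMr; lra.
have hh : (2 * N + L) * h0 = 1 by rewrite /h0; field; rewrite gt_eqF//; lra.
pose delta := h0 / 3; have delta0 : 0 < delta by exact: divr_gt0.
have [eps1 e10 hgap] := gap_lower_bound delta0.
have [eps [eps0 e1 e2 _ _]] := @ex_small4 R delta (eps1 / (2 * K)) 1 1 delta0
  (divr_gt0 e10 (mulr_gt0 (ltr0Sn _ 1) K0)) ltr01 ltr01.
exists eps => // lam mu good lm ml mL.
have Ke : K * (2 * eps) < eps1.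
  by move: e2; rewrite ltr_pdivlMr ?mulr_gt0//; lra.
apply: (@narrow_strip delta h0 lam) => //.
- lra.
- lra.
- have d1 : (mu - (lam - delta)) ^+ 2 <= 4 * delta ^+ 2.
    rewrite (_ : 4 * delta ^+ 2 = (2 * delta) ^+ 2); last by ring.
    by rewrite ler_pXn2r ?nnegrE//; lra.
  have d2 : delta ^+ 2 <= h0 / 2 / 9 by rewrite /delta; nra.
  lra.
move=> x dx xk.
have lL : lam <= Lam by lra.
have h1 := hgap lam x lL good dx xk.
have mT1 := mirror_T mL (ltW dx); have mT2 := mirror_T lL (ltW dx).
have h2 : `|mirror k mu x - mirror k lam x| <= 2 * eps.
  rewrite /mirror opprD addrACA subrr add0r -scalerBl norm_e ger0_norm; lra.
have h3 := u_near mT1 mT2 h2.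
by move: h1; rewrite /gap !mulN1r; lra.
Qed.

Lemma below_mirror_all lam : l0 <= lam -> lam <= Lam -> below_mirror lam.
Proof.
have [eps eps0 adv] := advance.
have h j mu : l0 <= mu -> mu <= l0 + j%:R * eps -> mu <= Lam -> below_mirror mu.
  elim: j mu => [|j IH] mu m1 m2 m3.
    move=> x dx xk; have := d_low x; move: m2; rewrite mul0r; lra.
  have [ml|ml] := leP mu (l0 + j%:R * eps); first exact: IH.
  have je : 0 <= j%:R * eps by rewrite mulr_ge0// ltW.
  apply: (adv (l0 + j%:R * eps)) => //.
  - by apply: IH; lra.
  - exact: ltW.
  - by move: m2; rewrite -natr1 mulrDl mul1r; lra.
move=> l1 l2; apply: (h (Num.truncn ((lam - l0) / eps)).+1) => //.
have : (lam - l0) / eps < (Num.truncn ((lam - l0) / eps)).+1%:R by exact: truncnS_gt.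
rewrite ltr_pdivrMr//; lra.
Qed.

(** [ball_barrier] in a ball tangent from below to the hyperplane through [x]: the
    barrier has a nonzero normal derivative at the point of tangency. *)
Lemma hopf x : 0 < d x -> x ord0 k <= Lam -> exists2 c : R, 0 < c &
  \forall s \near (0 : R)^'+, c * s <= u (x + s *: e) - u (x + (- s) *: e).
Proof.
move=> dx xL; have TL := T_Lam; have ll := l0_Lam; have dim_ge1 := dim_ge1; have L0' := L0.
have G1' := G1.
pose lam := x ord0 k.
have good : below_mirror lam by apply: below_mirror_all => //; have := d_low x; rewrite /lam; lra.
have [r [r0 r1 r2 _ _]] := @ex_small4 R 1 (d x / (3 * G)) 1 1 ltr01
  (divr_gt0 dx (mulr_gt0 (ltr0Sn _ 2) G_gt0)) ltr01 ltr01.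
have rG : 3 * (G * r) < d x by move: r2; rewrite ltr_pdivlMr ?mulr_gt0// ?G_gt0//; lra.
have rrG : r <= G * r by rewrite ler_peMl// ltW.
have r20 : 0 < r / 2 by exact: divr_gt0.
have [b b0 hb] := gap_lower_bound r20.
pose z := x + (- r) *: e.
have dz : d z = d x - r by rewrite d_up.
have zk : z ord0 k = lam - r by rewrite up_coord.
pose A := 4 * (N + L); have A0 : 0 < A by rewrite /A; lra.
have rr0 : 0 < r ^+ 2 by exact: exprn_gt0.
pose al := A / r ^+ 2; have al0 : 0 < al by exact: divr_gt0.
pose E := expR (- al * r ^+ 2); have E0 : 0 < E by exact: expR_gt0.
have inom v : sq (v - z) <= r ^+ 2 -> 0 < d v /\ v ord0 k <= lam.
  move=> hv; have h3 : `|v - z| <= r by apply: sq_le_norm => //; exact: ltW.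
  by have := d_near h3; have := coord_near h3; rewrite dz zk; lra.
have inom' v : sq (v - z) < r ^+ 2 -> v ord0 k < lam.
  move=> hv; have h3 : `|v - z| < r by exact: sq_lt_norm.
  have := le_lt_trans (norm_coord _ k) h3.
  have cB (w : 'rV[R]_n) : (v - w) ord0 k = v ord0 k - w ord0 k by rewrite !mxE.
  by rewrite cB zk ltr_norml; lra.
have gap0 v : 0 < d v -> v ord0 k <= lam -> 0 <= gap lam v.
  move=> dv; rewrite le_eqVlt => /predU1P[vk|]; last exact: below_gap.
  have mv : mirror k lam v = v by rewrite /mirror vk subrr mulr0 scale0r addr0.
  by rewrite /gap mv; lra.
have bar v : sq (v - z) <= r ^+ 2 -> b * (gauss al z v - E) <= gap lam v.
  apply: (@ball_barrier R n (gap lam) z ((r / 2) ^+ 2) r al L 0 b) => //.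
  - exact: gap_cont.
  - exact: ltW.
  - exact: ltW.
  - by move=> w /inom[dw wk]; exact: gap0.
  - move=> w hw; have h3 : `|w - z| <= r / 2 by apply: sq_le_norm => //; exact: ltW.
    apply: hb => //; have := d_near h3; have := coord_near h3; rewrite dz zk; lra.
  - move=> w _ /ltW /inom[dw wk].
    have [l hl lapl] := gap_lap xL dw wk.
    by exists l => //; rewrite addr0; move: hl; rewrite ger0_norm// gap0.
  - apply: mulr_gt0; first exact: mulr_gt0.
    have -> : 4 * al ^+ 2 * (r / 2) ^+ 2 - 2 * n%:R * al - L = (A ^+ 2 - 2 * N * A) / r ^+ 2 - L.
      by rewrite /al -/N; field; rewrite gt_eqF.
    rewrite subr_gt0 ltr_pdivlMr//.
    apply: (@le_lt_trans _ _ L).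
      by rewrite ler_piMr ?(ltW L0)// expr_le1// ltW.
    rewrite /A; nra.
exists (b * E * al * r); first exact: mulr_gt0 (mulr_gt0 (mulr_gt0 b0 E0) al0) r0.
near=> s.
have s0 : 0 < s by near: s; exact: nbhs_right_gt.
have sr : s < r by near: s; exact: nbhs_right_lt.
pose v := x + (- s) *: e.
have vz : sq (v - z) = (r - s) ^+ 2.
  have -> : v - z = 0 + (r - s) *: e.
    rewrite /v /z opprD addrACA subrr add0r add0r -scaleNr opprK -scalerDl.
    by congr (_ *: e); ring.
  rewrite sq_line mxE mulr0 mul0r addr0 sqE big1 ?add0r// => i _; rewrite mxE expr0n//.
have hv : sq (v - z) <= r ^+ 2 by rewrite vz ler_pXn2r ?nnegrE//; lra.
have := bar v hv.
have -> : gap lam v = u (x + s *: e) - u (x + (- s) *: e).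
  rewrite /gap mulN1r /v mirror_up opprK; congr (u (_ + _) - _).
  by rewrite /mirror /lam subrr mulr0 scale0r addr0.
apply: le_trans.
have -> : gauss al z v = E * expR (al * (r ^+ 2 - (r - s) ^+ 2)).
  by rewrite /gauss vz /E -expRD; congr expR; ring.
have h1 := expR_ge1Dx (al * (r ^+ 2 - (r - s) ^+ 2)).
have h2 : al * (r * s) <= al * (r ^+ 2 - (r - s) ^+ 2).
  by apply: ler_wpM2l; [exact: ltW|nra].
have h3 : E * (al * (r * s)) <= E * (expR (al * (r ^+ 2 - (r - s) ^+ 2)) - 1).
  by apply: ler_wpM2l; [exact: ltW|lra].
have h4 : b * (E * (al * (r * s))) <= b * (E * (expR (al * (r ^+ 2 - (r - s) ^+ 2)) - 1)).
  by rewrite ler_pM2l.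
by lra.
Unshelve. all: by end_near. Qed.

End MovingPlanes.

(** * Increments on the line and local Lipschitz bounds *)

Section OneVariable.
Variable R : realType.
Implicit Types (phi : R -> R) (a b c s K : R).

Lemma derive0_quot phi a : is_derive (0 : R) 1 phi a -> phi 0 = 0 ->
  h^-1 * phi h @[h --> (0 : R)^'+] --> a.
Proof.
move=> [dp <-] p0.
have dp2 : h^-1 *: ((phi \o shift 0) (h *: 1) - phi 0) @[h --> (0 : R)^'] --> 'D_1 phi 0.
  exact: dp.
have : h^-1 * phi h @[h --> (0 : R)^'] --> 'D_1 phi 0.
  apply: cvg_trans dp2; apply: near_eq_cvg; near=> h.
  by rewrite /= /shift/= addr0 p0 subr0 [h *: 1]mulr1.
exact: cvg_dnbhs_at_right.
Unshelve. all: by end_near. Qed.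

Lemma derive0_pos phi a : is_derive (0 : R) 1 phi a -> phi 0 = 0 -> 0 < a ->
  \forall s \near (0 : R)^'+, 0 < phi s.
Proof.
move=> dp p0 a0; have h := @cvgr_gt _ _ _ _ _ _ (derive0_quot dp p0) _ a0.
near=> s.
have s0 : 0 < s by near: s; exact: nbhs_right_gt.
have : 0 < s^-1 * phi s by near: s; exact: h.
by rewrite pmulr_rgt0// invr_gt0.
Unshelve. all: by end_near. Qed.

Lemma derive0_lower phi a c : is_derive (0 : R) 1 phi a -> phi 0 = 0 ->
  (\forall s \near (0 : R)^'+, c * s <= phi s) -> c <= a.
Proof.
move=> dp p0 hc; have h := derive0_quot dp p0.
refine (cvgr_to_ge h _).
near=> s.
have s0 : 0 < s by near: s; exact: nbhs_right_gt.
rewrite mulrC ler_pdivlMr//.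
by near: s.
Unshelve. all: by end_near. Qed.

(** After its last zero the function is differentiable, and up to that zero a
    nonnegative function cannot have increased.  This is what lets segments
    cross the boundary of the domain when a solution is extended by zero. *)
Lemma increment_le phi dphi K : 0 <= K -> continuous phi -> (forall s, 0 <= phi s) ->
  (forall s, 0 <= s <= 1 -> phi s != 0 ->
     is_derive (s : R) 1 phi (dphi s) /\ `|dphi s| <= K) ->
  phi 1 - phi 0 <= K.
Proof.
move=> K0 cphi phi0 hd.
have key a : 0 <= a -> a < 1 -> (forall s, a < s < 1 -> phi s != 0) ->
    phi 1 - phi a <= K.
  move=> a0 a1 nz.
  have ds s : s \in `]a, 1[ -> is_derive (s : R) 1 phi (dphi s).
    by rewrite in_itv/= => s1; apply: (hd s _ (nz s s1)).1; lra.
  have [c + ->] := MVT a1 ds (continuous_subspaceT cphi).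
  rewrite in_itv/= => c1.
  have : `|dphi c| <= K by apply: (hd c _ (nz c c1)).2; lra.
  rewrite ler_norml => /andP[_ h].
  by apply: le_trans (_ : K * (1 - a) <= _); [rewrite ler_pM2r//; lra|rewrite ler_piMr//; lra].
pose Z := [set s : R | phi s = 0] `&` `[0, 1].
have [Z0|Z0] := pselect (Z !=set0); last first.
  apply: key => // s s1; apply/eqP => E; apply: Z0; exists s; split=> //=.
  by rewrite in_itv/=; lra.
have cZ : compact Z.
  apply: subclosed_compact (@segment_compact R 0 1) _; last by move=> s [].
  apply: closedI; last exact: interval_closed.
  apply: (@closed_comp _ _ phi [set 0]) => [s _|]; first exact: cphi.
  exact: closed_eq.
have [a /set_mem[/= pa]] := @compact_EVT_max _ R (@id R) Z Z0 cZ
  (continuous_subspaceT (fun x : R => @cvg_id _ (nbhs x))).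
rewrite in_itv/= => /andP[a0 a1] amax.
move: a1; rewrite le_eqVlt => /predU1P[a1|a1].
  by rewrite -a1 pa; have := phi0 0; lra.
apply: le_trans (key a a0 a1 _); first by rewrite pa lerD2l lerN2.
move=> s s1; apply/eqP => E.
have : s <= a by apply: amax; apply/mem_set; split => //=; rewrite in_itv/=; lra.
lra.
Qed.

Lemma locally_lipschitz_segment (f : R -> R) (B : R) : 0 <= B ->
  locally_lipschitz f -> exists2 L : R, 0 < L &
  forall a b, 0 <= a <= B -> 0 <= b <= B -> `|f a - f b| <= L * `|a - b|.
Proof.
move=> B0 hf.
have loc x : exists r L : R, [/\ 0 < r, 0 < L & forall a b, `|x - a| < r -> `|x - b| < r ->
    `|f a - f b| <= L * `|a - b|].
  have [A /nbhs_ballP[r /= r0 hr] [M [_ hM]]] := hf x.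
  exists r, (`|M| + 1); split=> //.
  have MM : M < `|M| + 1 by apply: le_lt_trans (ler_norm M) _; rewrite ltrDl.
  by move=> a b xa xb; apply: (hM _ MM (a, b)); split; apply: hr.
(* Lipschitz bounds on [[0, c]] exist up to the right end: at the supremum of
   the admissible [c], a local bound would extend them. *)
pose S := [set c : R | 0 <= c <= B /\ exists2 L : R, 0 < L &
  forall a b, 0 <= a <= c -> 0 <= b <= c -> `|f a - f b| <= L * `|a - b|].
have S0 : S 0.
  split; first by rewrite lexx.
  exists 1 => // a b /andP[a1 a2] /andP[b1 b2].
  have -> : a = 0 by apply/eqP; rewrite eq_le a1 a2.
  have -> : b = 0 by apply/eqP; rewrite eq_le b1 b2.
  by rewrite !subrr normr0 mulr0.
have hS : has_sup S by split; [exists 0|exists B => c [/andP[_ ?] _]].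
have [r [L1 [r0 L10 h1]]] := loc (sup S).
have [c [/andP[c0 cB] [L0 L00 h0]] cr] := sup_adherent r0 hS.
have cs : c <= sup S.
  by apply: ub_le_sup; [exact: hS.2|split; [rewrite c0 cB|exists L0]].
pose c' := Num.min B (sup S + r / 2).
have c'B : c' <= B by rewrite ge_min lexx.
have c's : c' <= sup S + r / 2 by rewrite ge_min lexx orbT.
have ordered a b : 0 <= a -> a <= b -> b <= c' -> `|f a - f b| <= (L0 + L1) * `|a - b|.
  move=> a0 ab bc.
  have far x : c <= x -> x <= c' -> `|sup S - x| < r by move=> *; rewrite ltr_norml; lra.
  have [bc0|bc0] := leP b c.
    apply: le_trans (h0 a b _ _) _; [lra|lra|].
    by apply: ler_wpM2r => //; lra.
  have [ac0|ac0] := leP c a.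
    apply: le_trans (h1 a b _ _) _; [apply: far; lra|apply: far; lra|].
    by apply: ler_wpM2r => //; lra.
  have -> : f a - f b = (f a - f c) + (f c - f b) by rewrite addrA subrK.
  apply: le_trans (ler_normD _ _) _.
  have e1 : `|f a - f c| <= L0 * `|a - c| by apply: h0; lra.
  have e2 : `|f c - f b| <= L1 * `|c - b| by apply: h1; apply: far; lra.
  have -> : `|a - b| = `|a - c| + `|c - b|.
    by rewrite (@ler0_norm _ (a - b)) ?(@ler0_norm _ (a - c)) ?(@ler0_norm _ (c - b)); lra.
  have e3 : 0 <= L0 * `|c - b| by rewrite mulr_ge0// ltW.
  have e4 : 0 <= L1 * `|a - c| by rewrite mulr_ge0// ltW.
  lra.
have Sc' : S c'.
  split; first by rewrite c'B le_min B0; lra.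
  exists (L0 + L1); first by lra.
  move=> a b /andP[a0 ac] /andP[b0 bc].
  have [ab|/ltW ab] := leP a b; first exact: ordered.
  by rewrite distrC (distrC a); exact: ordered.
have c'S : c' <= sup S by apply: ub_le_sup => //; exact: hS.2.
have <- : c' = B.
  by apply/eqP; rewrite eq_le c'B /=; move: c'S; rewrite /c' le_min ge_min; lra.
by case: Sc'.
Qed.

End OneVariable.

(** * Gradients and directional derivatives *)

Section Gradient.
Variables (R : realType) (n : nat).
Implicit Types (F : 'rV[R]_n -> R) (x y v a : 'rV[R]_n) (s : R).

Lemma derivable_along F x v s : derivable F (x + s *: v) v ->
  is_derive (s : R) 1 (fun s => F (x + s *: v)) ('D_v F (x + s *: v)).
Proof.
move=> dF.
have E : (fun h : R => h^-1 *: (((fun s => F (x + s *: v)) \o shift s) (h *: 1) - F (x + s *: v))) =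
  (fun h : R => h^-1 *: ((F \o shift (x + s *: v)) (h *: v) - F (x + s *: v))).
  apply/funext => h; rewrite /= /shift/=; congr (_ *: (F _ - _)).
  by rewrite [h *: 1]mulr1 scalerDl addrCA.
by split; rewrite /derivable /derive E.
Qed.

Lemma derive_grad F a v : differentiable F a -> 'D_v F a = dotv (grad F a) v.
Proof.
move=> dF; rewrite deriveE// {1}(row_sum_delta v) linear_sum/=.
apply: eq_bigr => i _; rewrite linearZ/= /grad mxE /partial deriveE//.
by rewrite /GRing.scale/= mulrC.
Qed.

Lemma is_derive_along F x v s : differentiable F (x + s *: v) ->
  is_derive (s : R) 1 (fun s => F (x + s *: v)) (dotv (grad F (x + s *: v)) v).
Proof.
by move=> dF; rewrite -derive_grad//; apply: derivable_along; exact: diff_derivable.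
Qed.

Lemma enorm_coord a i : `|a ord0 i| <= enorm a.
Proof.
rewrite -sqrtr_sqr; apply: ler_wsqrtr; exact: (sq_coord a i).
Qed.

Lemma norm_le_enorm a : `|a| <= enorm a.
Proof. by apply: norm_le; [exact: sqrtr_ge0|exact: enorm_coord]. Qed.

Lemma dotv_bound a v (A r : R) : enorm a <= A -> `|v| <= r ->
  `|dotv a v| <= n%:R * A * r.
Proof.
move=> aA vr; rewrite /dotv; apply: le_trans (ler_norm_sum _ _ _) _.
have -> : n%:R * A * r = \sum_(i < n) A * r by rewrite sumr_const card_ord mulr_natl mulrnAl.
apply: ler_sum => i _; rewrite normrM; apply: ler_pM => //.
  exact: le_trans (enorm_coord _ _) aA.
exact: le_trans (norm_coord _ _) vr.
Qed.

Lemma segment_lipschitz F (A : R) : (forall x, differentiable F x) ->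
  (forall x, enorm (grad F x) <= A) -> forall x y, `|F x - F y| <= n%:R * A * `|x - y|.
Proof.
move=> dF hA x y; pose phi s := F (y + s *: (x - y)).
have dphi s : is_derive (s : R) 1 phi (dotv (grad F (y + s *: (x - y))) (x - y)).
  exact: is_derive_along.
have [|c _] := @MVT R phi _ 0 1 ltr01 (fun s _ => dphi s).
  by apply: derivable_within_continuous => s _; apply: ex_derive.
rewrite /phi scale1r scale0r addr0 [y + (x - y)]addrC subrK subr0 mulr1 => ->.
exact: dotv_bound.
Qed.

End Gradient.

(** * The geometry of an epigraph *)

Section Epigraph.
Variables (R : realType) (m : nat) (g : 'rV[R]_m -> R).
Implicit Types (x y v : 'rV[R]_(m + 1)) (s t : R).
Let k := last_coord m.
Let e : 'rV[R]_(m + 1) := delta_mx ord0 k.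

Definition depth x := xlast x - g (lsubmx x).

Lemma epigraphE x : epigraph g x <-> 0 < depth x.
Proof. by rewrite /depth subr_gt0. Qed.

Lemma lsubmx_e s : lsubmx (s *: e) = 0.
Proof.
apply/rowP => i; rewrite !mxE /e /k /last_coord.
by rewrite eqxx/= (_ : _ == _ = false) ?mulr0//; apply/negbTE; rewrite eq_lrshift.
Qed.

Lemma xlastD x y : xlast (x + y) = xlast x + xlast y.
Proof. by rewrite /xlast mxE. Qed.

Lemma xlastZ s y : xlast (s *: y) = s * xlast y.
Proof. by rewrite /xlast mxE. Qed.

Lemma xlast_e : xlast e = 1.
Proof. by rewrite /xlast /e mxE !eqxx. Qed.

Lemma depth_up x s : depth (x + s *: e) = depth x + s.
Proof. by rewrite /depth raddfD/= lsubmx_e addr0 xlastD xlastZ xlast_e mulr1 addrAC. Qed.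

Lemma norm_lsubmx x : `|lsubmx x| <= `|x|.
Proof. by apply: norm_le => // i; rewrite mxE norm_coord. Qed.

Lemma depth_lip (A : R) : (forall a b, `|g a - g b| <= A * `|a - b|) -> 0 <= A ->
  forall x y, `|depth x - depth y| <= (1 + A) * `|x - y|.
Proof.
move=> hA A0 x y.
have -> : depth x - depth y = (x - y) ord0 k + (g (lsubmx y) - g (lsubmx x)).
  by rewrite /depth /xlast !mxE; ring.
apply: le_trans (ler_normD _ _) _; rewrite mulrDl mul1r; apply: lerD.
  exact: norm_coord.
apply: le_trans (hA _ _) _; apply: ler_wpM2l => //.
rewrite distrC; apply: le_trans (norm_lsubmx _).
by rewrite raddfB.
Qed.

Hypothesis g_diff : forall a, differentiable g a.

Lemma lsubmx_cont : continuous (@lsubmx R 1 m 1).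
Proof.
move=> x A /near_norm[r r0 hr]; apply/near_norm; exists r => // y xy.
apply: hr; apply: le_lt_trans xy.
by rewrite -raddfB; exact: norm_lsubmx.
Qed.

Lemma depth_cont : continuous depth.
Proof.
apply: (@continuous_addf _ _ (@xlast R m) (fun x => - g (lsubmx x))); first exact: coord_cont.
apply: continuous_oppf => x.
apply: (@continuous_comp _ _ _ (@lsubmx R 1 m 1) g); first exact: lsubmx_cont.
exact: differentiable_continuous.
Qed.

Lemma is_derive_depth x v : is_derive (0 : R) 1 (fun s => depth (x + s *: v))
  (xlast v - dotv (grad g (lsubmx x)) (lsubmx v)).
Proof.
have h1 : is_derive (0 : R) 1 (fun s => g (lsubmx x + s *: lsubmx v))
    (dotv (grad g (lsubmx x)) (lsubmx v)).
  rewrite -[X in grad g X]addr0 -[X in grad g (_ + X)](scale0r (lsubmx v)).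
  exact: is_derive_along.
have h2 : is_derive (0 : R) 1 (fun s => xlast x + xlast v * s + 0 * s ^+ 2) (xlast v).
  have := is_derive_quadratic 0 (xlast v) (xlast x) 0.
  by rewrite mulr0 addr0.
have := is_deriveB h2 h1; congr (is_derive _ _ _ _).
apply/funext => s; rewrite /depth !fctE xlastD xlastZ mul0r addr0 raddfD/=.
by rewrite linearZ/= (mulrC s).
Qed.

Lemma closure_epigraph x : closure (epigraph g) x <-> 0 <= depth x.
Proof.
split.
  have : epigraph g `<=` [set y | 0 <= depth y] by move=> y /epigraphE/ltW.
  move=> /closureS sub /sub; rewrite -(closure_id _).1//.
  apply: closed_gef; exact: depth_cont.
move=> dx B /near_norm[r r0 hr]; exists (x + (r / 2) *: e); split.
  by apply/epigraphE; rewrite depth_up ltr_wpDl// divr_gt0.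
apply: hr; rewrite opprD addrA subrr add0r normrN (norm_e k) gtr0_norm ?divr_gt0//.
by rewrite ltr_pdivrMr// ltr_pMr// ltr1n.
Qed.

Lemma boundary_epigraph x : boundary (epigraph g) x <-> depth x = 0.
Proof.
split=> [[/closure_epigraph d0 nx]|d0].
  apply/eqP; rewrite eq_le d0 andbT leNgt; apply/negP => dx; apply: nx.
  have := near_gt depth_cont dx; apply: filterS => y; exact: (epigraphE y).2.
split; first by apply/closure_epigraph; rewrite d0.
by move=> /interior_subset/epigraphE; rewrite d0 ltxx.
Qed.

Definition normal_vector x : 'rV[R]_(m + 1) :=
  (Num.sqrt (1 + sq (grad g (lsubmx x))))^-1 *:
    row_mx (grad g (lsubmx x)) (const_mx (- 1)).

Lemma dotv_row v (q : 'rV[R]_m) (c : R) :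
  dotv v (row_mx q (const_mx c)) = dotv (lsubmx v) q + xlast v * c.
Proof.
rewrite /dotv big_split_ord/= big_ord1 row_mxEr mxE; congr (_ + _).
by apply: eq_bigr => i _; rewrite row_mxEl [in RHS]mxE.
Qed.

Lemma dotvC n (v w : 'rV[R]_n) : dotv v w = dotv w v.
Proof. by apply: eq_bigr => i _; rewrite mulrC. Qed.

Lemma dotvZr n (v w : 'rV[R]_n) (c : R) : dotv v (c *: w) = c * dotv v w.
Proof. by rewrite /dotv mulr_sumr; apply: eq_bigr => i _; rewrite mxE mulrCA. Qed.

Lemma normal_slope x : xlast (normal_vector x) -
  dotv (grad g (lsubmx x)) (lsubmx (normal_vector x)) =
  - Num.sqrt (1 + sq (grad g (lsubmx x))).
Proof.
rewrite /normal_vector linearZ/= row_mxKl dotvZr xlastZ -/(sq _).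
have -> : xlast (row_mx (grad g (lsubmx x)) (const_mx (- 1))) = - 1 :> R.
  by rewrite /xlast row_mxEr mxE.
have h : 0 < 1 + sq (grad g (lsubmx x)) by rewrite ltr_wpDr// sq_ge0.
rewrite -mulrBr -opprD mulrN; congr (- _).
rewrite -[X in _ * X]sqr_sqrtr ?(ltW h)// expr2 mulrA mulVf ?mul1r//.
by rewrite gt_eqF// sqrtr_gt0.
Qed.

Lemma is_derive_comp_depth (c : R -> 'rV[R]_(m + 1)) v :
  is_derive (0 : R) 1 c v ->
  is_derive (0 : R) 1 (fun t => depth (c t))
    (xlast v - dotv (grad g (lsubmx (c 0))) (lsubmx v)).
Proof.
move=> [dc vE].
have cdiff : differentiable c 0 by apply/derivable1_diffP.
have lin : differentiable (@lsubmx R 1 m 1) (c 0).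
  exact: linear_differentiable lsubmx_cont.
have h1 : is_derive (0 : R) 1 (g \o (@lsubmx R 1 m 1 \o c)) (dotv (grad g (lsubmx (c 0))) (lsubmx v)).
  have q0 : differentiable (@lsubmx R 1 m 1 \o c) 0 by exact: differentiable_comp.
  have gq : differentiable (g \o (@lsubmx R 1 m 1 \o c)) 0 by exact: differentiable_comp.
  split; first by apply: diff_derivable.
  have dl := @diff_lin R 'rV[R]_(m + 1) 'rV[R]_m (@lsubmx R 1 m 1) (c 0) lsubmx_cont.
  have E1 := diff_comp cdiff lin.
  have E2 := diff_comp q0 (g_diff ((@lsubmx R 1 m 1 \o c) 0)).
  rewrite deriveE// E2 [LHS]/= E1 [LHS]/= dl.
  have -> : 'd c 0 1 = v by rewrite -vE deriveE.
  by rewrite -derive_grad// deriveE.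
have h2 : is_derive (0 : R) 1 (fun t => xlast (c t)) (xlast v).
  have cv : h^-1 *: ((c \o shift 0) (h *: 1) - c 0) @[h --> (0 : R)^'] --> v.
    by rewrite -vE; exact: dc.
  have cv2 : xlast (h^-1 *: ((c \o shift 0) (h *: 1) - c 0)) @[h --> (0 : R)^'] --> xlast v.
    by apply: (cvg_comp _ _ cv); exact: coord_cont.
  have E : (fun h : R => xlast (h^-1 *: ((c \o shift 0) (h *: 1) - c 0))) =
     (fun h : R => h^-1 *: (((fun t => xlast (c t)) \o shift 0) (h *: 1) - xlast (c 0))).
    by apply/funext => h; rewrite /xlast !mxE.
  rewrite E in cv2.
  split; first by apply/cvg_ex; exists (xlast v).
  by apply/cvg_lim.
exact: is_deriveB h2 h1.
Qed.

Lemma normal_vectorP x : depth x = 0 ->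
  outward_unit_normal (epigraph g) x (normal_vector x).
Proof.
move=> dx.
have h : 0 < 1 + sq (grad g (lsubmx x)) by rewrite ltr_wpDr// sq_ge0.
have s0 : 0 < Num.sqrt (1 + sq (grad g (lsubmx x))) by rewrite sqrtr_gt0.
split.
- rewrite /enorm dotvZr dotvC dotvZr dotv_row row_mxKl -/(sq _).
  rewrite /xlast row_mxEr mxE mulrNN mulr1 mulrA -expr2 exprVn sqr_sqrtr ?(ltW h)//.
  by rewrite addrC mulVf ?sqrtr1// gt_eqF// addrC.
- move=> v [c [c0 cb dc]].
  have dd := is_derive_comp_depth dc.
  have : is_derive (0 : R) 1 (fun t => depth (c t)) 0.
    apply: (@near_eq_is_derive _ _ _ (cst 0)).
    by apply: filterS cb => t /boundary_epigraph ->.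
  move=> /@derive_val; rewrite (@derive_val _ _ _ _ _ _ _ dd) c0 => E.
  rewrite /normal_vector dotvZr dotv_row mulrN1 dotvC.
  by rewrite -[_ - _]opprB E oppr0 mulr0.
- have := derive0_pos (phi := fun t => - depth (x + t *: normal_vector x))
    (is_deriveN (is_derive_depth x (normal_vector x))).
  rewrite scale0r addr0 dx oppr0 normal_slope opprK => /(_ erefl s0).
  by apply: filterS => t h1 /closure_epigraph; rewrite leNgt -oppr_gt0 h1.
Qed.

End Epigraph.

(** * Extending the solution by zero *)

Lemma cvg_lincomb (R : realType) (n : nat) (T : Type) (F : set_system T) {FF : Filter F}
    (h : 'I_n -> T -> R) (l v : 'I_n -> R) :
  (forall i, h i y @[y --> F] --> l i) ->
  \sum_i h i y * v i @[y --> F] --> \sum_i l i * v i.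
Proof.
move=> hl; elim: (index_enum _) => [|i r IH].
  rewrite big_nil (_ : (fun y => _) = (fun=> 0)); first exact: cvg_cst.
  by apply/funext => y; rewrite big_nil.
rewrite big_cons (_ : (fun y => _) = (fun y => h i y * v i + \sum_(j <- r) h j y * v j)).
  by apply: cvgD => //; apply: cvgM => //; exact: cvg_cst.
by apply/funext => y; rewrite big_cons.
Qed.

Section Extension.
Variables (R : realType) (m : nat) (g : 'rV[R]_m -> R) (u : 'rV[R]_(m + 1) -> R).
Implicit Types (x y v P : 'rV[R]_(m + 1)) (s t : R).
Let k := last_coord m.
Let Om := epigraph g.
Let d := depth g.

Definition zero_ext x : R := if 0 < d x then u x else 0.

Hypothesis g_diff : forall a, differentiable g a.
Hypothesis u_C1 : Ck_closure 1 Om u.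
Hypothesis u_C2 : Ck 2 Om u.
Hypothesis u_gt0 : forall x, Om x -> 0 < u x.
Hypothesis u_bd : forall x, boundary Om x -> u x = 0.

Lemma u_diff x : 0 < d x -> differentiable u x.
Proof. by move=> dx; apply: u_C2.1; apply/epigraphE. Qed.

Lemma zero_ext_in x : 0 < d x -> zero_ext x = u x.
Proof. by rewrite /zero_ext => ->. Qed.

Lemma zero_ext_out x : d x <= 0 -> zero_ext x = 0.
Proof. by rewrite /zero_ext leNgt => /negbTE ->. Qed.

Lemma zero_ext_pos x : 0 < d x -> 0 < zero_ext x.
Proof. by move=> dx; rewrite zero_ext_in//; apply: u_gt0; apply/epigraphE. Qed.

Lemma zero_ext_ge0 x : 0 <= zero_ext x.
Proof. by have [/zero_ext_out ->|/zero_ext_pos/ltW] := leP (d x) 0. Qed.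

Lemma near_zero_ext x : 0 < d x -> \forall y \near x, u y = zero_ext y.
Proof.
move=> dx; have := near_gt (depth_cont g_diff) dx.
by apply: filterS => y dy; rewrite zero_ext_in.
Qed.

Lemma near_eq_continuous (F H : 'rV[R]_(m + 1) -> R) x :
  (\forall y \near x, F y = H y) -> continuous_at x F -> continuous_at x H.
Proof.
move=> FH cF A; have /near_norm[r r0 hr] := FH.
rewrite -(hr x) ?subrr ?normr0// => /cF /near_norm[q q0 hq].
apply/near_norm; exists (Num.min r q); first by rewrite lt_min r0.
by move=> y; rewrite lt_min => /andP[/hr/= <- /hq].
Qed.

(** At the graph this uses that [u] is continuous on the closure and vanishes
    there. *)
Lemma zero_ext_cont : continuous zero_ext.
Proof.
move=> x; have [dx|dx] := ltP 0 (d x).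
  apply: (near_eq_continuous (near_zero_ext dx)).
  exact: differentiable_continuous (u_diff dx).
have [d0|d0] := ltP (d x) 0.
  apply: (@near_eq_continuous (fun=> 0)); last exact: cst_continuous.
  have := near_lt (depth_cont g_diff) d0.
  by apply: filterS => y /ltW dy; rewrite zero_ext_out.
rewrite /continuous_at zero_ext_out//.
have dx0 : d x = 0 by apply/eqP; rewrite eq_le dx d0.
have ux : u x = 0 by apply: u_bd; apply/(boundary_epigraph g_diff).
have [_ uc _] := u_C1.
have xc : closure Om x by apply/(closure_epigraph g_diff).
move=> A /nbhs_ballP[r /= r0 hr].
have : nbhs (u x) (ball (u x) r) by exact: nbhsx_ballx.
have /subspace_continuousP/(_ x xc) := uc.
move=> /[apply]; rewrite /nbhs/= => /near_norm[q q0 hq].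
apply/near_norm; exists q => // y xy; apply: hr.
have [dy|dy] := ltP 0 (d y); last by rewrite zero_ext_out//; exact: ballxx.
rewrite zero_ext_in// -ux; apply: hq => //.
by apply/(closure_epigraph g_diff)/ltW.
Qed.

Lemma u_has_lap x : 0 < d x -> lap_at u x (laplacian u x).
Proof.
move=> dx; exists (fun i => partial i (partial i u) x); split=> // i.
exists (fun s => partial i u (x + s *: delta_mx ord0 i)); split.
  have h : \forall s \near (0 : R), 0 < d (x + s *: delta_mx ord0 i).
    exact: (@line_cvg R (m + 1) x i _ (near_gt (depth_cont g_diff) dx)).
  near=> s; have ds : 0 < d (x + s *: delta_mx ord0 i) by near: s.
  by apply: derivable_along; apply: diff_derivable; exact: u_diff.
have dp : differentiable (partial i u) x by apply: (u_C2.2 i).1; apply/epigraphE.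
have := @derivable_along R (m + 1) (partial i u) x (delta_mx ord0 i) 0.
by rewrite scale0r addr0; apply; exact: diff_derivable.
Unshelve. all: by end_near. Qed.

Lemma zero_ext_lap x : 0 < d x -> lap_at zero_ext x (laplacian u x).
Proof. by move=> dx; apply: lap_at_near (near_zero_ext dx) (u_has_lap dx). Qed.

Lemma line_cont x v : continuous (fun s : R => x + s *: v).
Proof.
move=> s; apply: cvgD; first exact: cvg_cst.
by apply: cvgZr_tmp; exact: cvg_id.
Qed.

Lemma zero_ext_line_cont x v : continuous (fun s => zero_ext (x + s *: v)).
Proof.
move=> s; apply: (@continuous_comp _ _ _ (fun s => x + s *: v) zero_ext).
  exact: line_cont.
exact: zero_ext_cont.
Qed.

Lemma zero_ext_along x v s : 0 < d (x + s *: v) ->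
  is_derive (s : R) 1 (fun s => zero_ext (x + s *: v)) (dotv (grad u (x + s *: v)) v).
Proof.
move=> ds; have ha := is_derive_along (u_diff ds).
apply: (near_eq_is_derive _ ha).
exact: (@line_cont x v s _ (near_zero_ext ds)).
Qed.

Lemma zero_ext_lip (T A : R) : 0 <= A ->
  (forall x, 0 < d x -> x ord0 k < T -> enorm (grad u x) <= A) ->
  forall x y, x ord0 k < T -> y ord0 k < T ->
  `|zero_ext x - zero_ext y| <= (m + 1)%:R * A * `|x - y|.
Proof.
move=> A0 hA.
have key x y : x ord0 k < T -> y ord0 k < T ->
    zero_ext x - zero_ext y <= (m + 1)%:R * A * `|x - y|.
  move=> xT yT.
  pose phi s := zero_ext (y + s *: (x - y)).
  have p1 : phi 1 = zero_ext x by rewrite /phi scale1r [y + _]addrC subrK.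
  have p0 : phi 0 = zero_ext y by rewrite /phi scale0r addr0.
  rewrite -p1 -p0.
  apply: (@increment_le _ phi (fun s => dotv (grad u (y + s *: (x - y))) (x - y))).
  - by rewrite !mulr_ge0.
  - exact: zero_ext_line_cont.
  - by move=> s; exact: zero_ext_ge0.
  move=> s /andP[s0 s1] ps.
  have ds : 0 < d (y + s *: (x - y)).
    by rewrite ltNge; apply: contra ps => /zero_ext_out; rewrite /phi => ->.
  split.
    exact: zero_ext_along.
  apply: dotv_bound => //; apply: hA => //.
  have -> : (y + s *: (x - y)) ord0 k = (1 - s) * y ord0 k + s * x ord0 k.
    by rewrite !mxE; ring.
  have [->|s00] := eqVneq s 0; first by rewrite subr0 mul1r mul0r addr0.
  have sp : 0 < s by rewrite lt_neqAle eq_sym s00.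
  have h1 : s * x ord0 k < s * T by rewrite ltr_pM2l.
  have h2 : (1 - s) * y ord0 k <= (1 - s) * T by apply: ler_wpM2l; [rewrite subr_ge0|exact: ltW].
  lra.
move=> x y xT yT; rewrite ler_norml key// andbT.
by have := key y x yT xT; rewrite distrC; lra.
Qed.

Variable c : R.
Hypothesis c_neq0 : c != 0.
Hypothesis u_normal : forall x eta, boundary Om x ->
  outward_unit_normal Om x eta -> bd_derive Om u x eta = c.

(** The boundary value of a partial derivative, defined as a limit, is an actual
    limit: the derivative has a continuous extension to the closure. *)
Lemma grad_boundary_cvg P i : d P = 0 ->
  partial i u y @[y --> within Om (nbhs P)] --> ext_val Om (partial i u) P.
Proof.
move=> dP; have [_ _ /(_ [:: i] isT)] := u_C1.
move=> [h /subspace_continuousP hc hE].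
have Pc : closure Om P by apply/(closure_epigraph g_diff); rewrite -/d dP.
have PF : ProperFilter (within Om (nbhs P)).
  split; last exact: within_filter.
  move=> /near_norm[r r0 hr].
  have [y [Oy yr]] := Pc (ball P r) (nbhsx_ballx P r r0).
  by apply: (hr y _ Oy); rewrite -ball_normE in yr.
have cv : partial i u y @[y --> within Om (nbhs P)] --> h P.
  move=> B /(hc P Pc); rewrite /nbhs/= => /near_norm[r r0 hr].
  apply/near_norm; exists r => // y Py Oy; have hB : B (h y) by apply: hr => //; exact: subset_closure.
  by rewrite (hE y Oy) in hB.
by rewrite /ext_val (cvg_lim _ cv).
Qed.

(** Along the inner normal the derivative of [u] tends to [- c].  Since [u] is
    positive inside and zero on the boundary, the mean value theorem excludes
    [c > 0], and for [c < 0] it makes the increments at least [|c| / 2] times the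
    distance close to the boundary. *)
Lemma zero_ext_slope P : d P = 0 -> exists2 nu : 'rV[R]_(m + 1), `|nu| <= 1 &
  \forall s \near (0 : R)^'+, `|c| / 2 * s <= zero_ext (P + s *: nu).
Proof.
move=> dP; pose eta := normal_vector g P.
have bP : boundary Om P by apply/(boundary_epigraph g_diff).
have on := normal_vectorP g_diff dP.
have bc : \sum_i ext_val Om (partial i u) P * eta ord0 i = c.
  rewrite -(u_normal bP on) /bd_derive /dotv.
  by apply: eq_bigr => i _; rewrite mxE.
have e1 : `|eta| <= 1.
  by apply: le_trans (norm_le_enorm _) _; have [-> _ _] := on.
exists (- eta); first by rewrite normrN.
have near_c : \forall y \near within Om (nbhs P), `|c - dotv (grad u y) eta| < `|c| / 2.
  have cv : dotv (grad u y) eta @[y --> within Om (nbhs P)] --> c.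
    rewrite -bc /dotv; under eq_fun do under eq_bigr do rewrite mxE.
    by apply: cvg_lincomb => i; exact: grad_boundary_cvg.
  have c2 : 0 < `|c| / 2 by rewrite divr_gt0// normr_gt0.
  exact: ((cvgrPdist_lt _ _).1 cv _ c2).
move: near_c => /near_norm[r r0 hr].
have slope := is_derive_depth g_diff P (- eta).
have nslope : xlast (- eta) - dotv (grad g (lsubmx P)) (lsubmx (- eta)) =
    Num.sqrt (1 + sq (grad g (lsubmx P))).
  have -> : lsubmx (- eta) = -1 *: lsubmx eta by rewrite raddfN scaleN1r.
  have -> : xlast (- eta) = - xlast eta by rewrite /xlast mxE.
  rewrite dotvZr mulN1r -opprD.
  by rewrite -[RHS]opprK -normal_slope.
have in_Om : \forall s \near (0 : R)^'+, 0 < d (P + s *: - eta).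
  have := derive0_pos slope; rewrite scale0r addr0 -/d dP => /(_ erefl); apply.
  by rewrite nslope sqrtr_gt0 ltr_wpDr// sq_ge0.
have [q [q0 hq]] : exists q : R, 0 < q /\ forall s, 0 < s -> s < q -> 0 < d (P + s *: - eta).
  have [q /= q0 hq] := in_Om; exists q; split=> // s s0 sq.
  by apply: hq => //=; rewrite sub0r normrN gtr0_norm.
near=> s.
have s0 : 0 < s by near: s; exact: nbhs_right_gt.
have sr : s < r by near: s; exact: nbhs_right_lt.
have sq' : s < q by near: s; exact: nbhs_right_lt.
pose phi t := zero_ext (P + t *: - eta).
have dphi t : t \in `]0, s[ -> is_derive (t : R) 1 phi (dotv (grad u (P + t *: - eta)) (- eta)).
  rewrite in_itv/= => /andP[t0 ts]; apply: zero_ext_along; apply: hq => //.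
  exact: lt_trans sq'.
have [t + phiE] := MVT s0 dphi (continuous_subspaceT (@zero_ext_line_cont P (- eta))).
rewrite in_itv/= => /andP[t0 ts].
have phi0 : phi 0 = 0 by rewrite /phi scale0r addr0 zero_ext_out// dP.
move: phiE; rewrite phi0 !subr0 => phiE.
have phis : 0 < phi s by apply: zero_ext_pos; exact: hq.
rewrite -/(phi s) phiE ler_pM2r//.
move: phis; rewrite phiE pmulr_lgt0//.
have := hr (P + t *: - eta).
have -> : dotv (grad u (P + t *: - eta)) (- eta) = - dotv (grad u (P + t *: - eta)) eta.
  by rewrite -[X in dotv _ X = _]scaleN1r dotvZr mulN1r.
move=> h pos; have {h} := h _ _.
rewrite opprD addrA subrr add0r normrN normrZ normrN gtr0_norm//.
have tr : t * `|eta| < r.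
  apply: (@le_lt_trans _ _ (t * 1)); first by rewrite ler_pM2l.
  by rewrite mulr1; exact: lt_trans sr.
have Ot : Om (P + t *: - eta) by apply/epigraphE; apply: hq => //; exact: lt_trans sq'.
move=> /(_ tr Ot); move: pos.
set D := dotv _ _ => pos; rewrite ltr_norml => /andP[h1 h2].
have [cp|cn] := ltP 0 c.
  by move: h1 h2; rewrite gtr0_norm//; lra.
by move: h1 h2; rewrite ler0_norm//; lra.
Unshelve. all: by end_near. Qed.

End Extension.

(** * Monotonicity *)

Unset Implicit Arguments.

Theorem theorem4p2 (R : realType) (m : nat) (hN : (2 <= m + 1)%N)
    (gamma : R) (gamma_gt0 : 0 < gamma) (gamma_le1 : gamma <= 1)
    (g : 'rV[R]_m -> R) (g_lb : has_lbound (range g))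
    (g_C1 : C1_holder gamma g)
    (f : R -> R) (f_lip : locally_lipschitz f) (f0 : f 0 < 0)
    (u : 'rV[R]_(m + 1) -> R)
    (u_C1 : Ck_closure 1 (epigraph g) u) (u_C2 : Ck 2 (epigraph g) u)
    (u_eq : forall x, epigraph g x -> - laplacian u x = f (u x))
    (u_gt0 : forall x, epigraph g x -> 0 < u x)
    (u_bd : forall x, boundary (epigraph g) x -> u x = 0)
    (c : R) (c_neq0 : c != 0)
    (u_normal : forall x eta, boundary (epigraph g) x ->
      outward_unit_normal (epigraph g) x eta ->
      bd_derive (epigraph g) u x eta = c)
    (u_strip : forall r : R, 0 < r ->
      has_ubound [set enorm (grad u x)
                 | x in epigraph g `&` [set x | xlast x < r]]) :
  forall x, epigraph g x -> 0 < partial (last_coord m) u x.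
Proof.
move=> x Ox.
have [[g_diff' _] [A hA] _] := g_C1.
have g_diff a : differentiable g a by exact: g_diff'.
have {}hA a : enorm (grad g a) <= A by apply: hA; exists a.
have A0 : 0 <= A by apply: le_trans (hA 0); exact: sqrtr_ge0.
have [l0 hl0] := g_lb.
have {}hl0 a : l0 <= g a by apply: hl0; exists a.
pose k := last_coord m; pose d := depth g; pose w := zero_ext g u.
have dx : 0 < d x by apply/epigraphE.
pose G := 1 + m%:R * A.
have mA0 : 0 <= m%:R * A by apply: mulr_ge0.
have d_lip := depth_lip (segment_lipschitz g_diff hA) mA0.
have d_low (y : 'rV[R]_(m + 1)) : d y <= y ord0 k - l0 by rewrite lerD2l lerN2.
(* Mirror images in hyperplanes no higher than [x] stay below height [T]. *)
pose T := 2 * x ord0 k - l0 + 1.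
have T0 : 0 < Num.max T 1 by rewrite lt_max ltr01 orbT.
have [A2 hA2] := u_strip _ T0.
pose K := (m + 1)%:R * (`|A2| + 1).
have A20 : 0 < `|A2| + 1 by rewrite ltr_wpDl.
have K0 : 0 < K by apply: mulr_gt0 => //; rewrite ltr0n addn1.
have w_lip (y z : 'rV[R]_(m + 1)) : y ord0 k < T -> z ord0 k < T -> `|w y - w z| <= K * `|y - z|.
  apply: (zero_ext_lip g_diff u_C1 u_C2 u_gt0 u_bd (ltW A20)) => v dv vT.
  apply: (@le_trans _ _ A2); last first.
    by apply: le_trans (ler_norm _) _; rewrite lerDl.
  apply: hA2; exists v => //; split; first by apply/epigraphE.
  by rewrite /= lt_max vT.
have x_low : l0 <= x ord0 k by have := d_low x; lra.
have TL : 0 <= T - l0 by rewrite /T; lra.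
pose B := K * (T - l0).
have B0 : 0 <= B by apply: mulr_ge0 => //; exact: ltW.
have w_B (y : 'rV[R]_(m + 1)) : y ord0 k < T -> 0 <= w y <= B.
  move=> yT; rewrite zero_ext_ge0//=.
  have [dy|dy] := leP (d y) 0; first by rewrite /w zero_ext_out.
  pose y' := y + (- d y) *: delta_mx ord0 k.
  have y'T : y' ord0 k < T by rewrite up_coord; lra.
  have wy' : w y' = 0 by rewrite /w zero_ext_out// /y' depth_up subrr.
  have := w_lip y y' yT y'T; rewrite wy' subr0.
  rewrite /y' opprD addrA subrr add0r normrN norm_e normrN (gtr0_norm dy).
  move=> h; apply: (le_trans (ler_norm _)); apply: (le_trans h).
  by apply: ler_wpM2l; [exact: ltW|have := d_low y; lra].
have [L L0 hL] := locally_lipschitz_segment B0 f_lip.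
have f_w (y z : 'rV[R]_(m + 1)) : y ord0 k < T -> z ord0 k < T -> `|f (w y) - f (w z)| <= L * `|w y - w z|.
  by move=> /w_B hy /w_B hz; exact: hL.
pose M := `|f 0| + L * B + 1.
have M0 : 0 < M by rewrite ltr_wpDl// addr_ge0// mulr_ge0// ltW.
have f_M (y : 'rV[R]_(m + 1)) : y ord0 k < T -> `|f (w y)| <= M.
  move=> /w_B hy; have h0 : 0 <= (0 : R) <= B by apply/andP; split.
  have := hL _ _ hy h0; rewrite subr0 => h.
  have -> : f (w y) = f 0 + (f (w y) - f 0) by rewrite addrC subrK.
  apply: le_trans (ler_normD _ _) _; rewrite /M -addrA lerD2l.
  apply: le_trans h _; case/andP: hy => h1 h2; rewrite ger0_norm//.
  have : L * w y <= L * B by rewrite ler_pM2l.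
  lra.
have w_lap y : 0 < d y -> lap_at w y (- f (w y)).
  move=> dy; rewrite /w zero_ext_in// -u_eq ?opprK; last by apply/epigraphE.
  exact: zero_ext_lap.
have C0 : 0 < `|c| / 2 by rewrite divr_gt0// normr_gt0.
have G1 : 1 <= G by rewrite lerDl.
have [q q0 hq] := hopf G1 d_lip (@depth_up R m g) d_low
  (zero_ext_cont g_diff u_C1 u_C2 u_bd) (@zero_ext_out R m g u)
  (@zero_ext_pos R m g u u_gt0) w_lap C0
  (@zero_ext_slope R m g u g_diff u_C1 u_C2 u_gt0 u_bd c c_neq0 u_normal)
  K0 M0 L0 w_lip f_M f_w x_low (lexx _) dx (lexx _).
pose e : 'rV[R]_(m + 1) := delta_mx ord0 k.
have dw : is_derive (0 : R) 1 (fun s => w (x + s *: e)) (partial k u x).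
  have := @zero_ext_along R m g u g_diff u_C2 x e 0.
  rewrite scale0r addr0 -derive_grad; last by apply: u_diff dx.
  exact.
have dw' : is_derive (0 : R) 1 (fun s => w (x + (- s) *: e)) (- partial k u x).
  have -> : - partial k u x = partial k u x * -1 by rewrite mulrN1.
  have dw0 : is_derive (- 0 : R) 1 (fun s => w (x + s *: e)) (partial k u x).
    by rewrite oppr0.
  exact: (@is_derive1_comp R _ -%R 0 _ _ dw0).
(* The odd difference quotient from [hopf] converges to twice the derivative. *)
have h := derive0_lower (is_deriveB dw dw').
have : q <= partial k u x - - partial k u x.
  by apply: h => //; rewrite !fctE oppr0 subrr.
by rewrite opprK -mulr2n -mulr_natl => /(lt_le_trans q0); rewrite pmulr_rgt0.
Qed.
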